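(* Universal Stochastic Metric Facility Location admits a deterministic polynomial-time $\frac{4e}{e-1}$-approximation algorithm with respect to the optimal universal solution in the independent activation model.
   Context: Universal Stochastic Metric Facility Location: given a set of clients $C$, a set of facilities $F$, opening costs $o_f\ge 0$ for $f\in F$, and connection costs $d(c,f)\ge 0$ for $c\in C,f\in F$ induced by a metric. A universal solution is a mapping $\phi:C\to F$. A random set $X\subseteq C$ is drawn from a distribution $\pi$; then all facilities $\phi(X)=\bigcup_{c\in X}\{\phi(c)\}$ are opened and each $c\in X$ is connected to $\phi(c)$. The cost of $\phi$ is $\mathbb{E}_{X\sim\pi}[\sum_{f\in\phi(X)}o_f+\sum_{c\in X}d(c,\phi(c))]$. The optimal universal solution minimizes this over all mappings; an $\alpha$-approximation outputs a mapping of expected cost at most $\alpha$ times this minimum. Independent activation model: each client $c$ is included in $X$ independently with a given probability $p_c$. *)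

(* Defs.v *)
From mathcomp Require Import all_boot all_order all_algebra.
From mathcomp Require Import reals Rstruct.
From mathcomp Require Import sequences.
Set Implicit Arguments. Unset Strict Implicit. Unset Printing Implicit Defensive.
Import Order.TTheory GRing.Theory Num.Theory.
Local Open Scope ring_scope.

(* Clients 'I_nC, facilities 'I_nF; data are rationals (so that the    *)
(* instance has a finite encoding for the complexity statement).       *)

Definition metric_induced (nC nF : nat) (d : {ffun 'I_nC * 'I_nF -> rat}) :=
  exists D : 'I_nC + 'I_nF -> 'I_nC + 'I_nF -> rat,
    [/\ forall x, D x x = 0,
        forall x y, D x y = D y x,
        forall x y z, D x z <= D x y + D y z
      & forall c f, d (c, f) = D (inl c) (inr f)].

Definition valid_instance (nC nF : nat) (o : {ffun 'I_nF -> rat})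
  (d : {ffun 'I_nC * 'I_nF -> rat}) (p : {ffun 'I_nC -> rat}) :=
  [/\ forall f, 0 <= o f,
      metric_induced d
    & forall c, 0 <= p c <= 1].

Definition act_prob (nC : nat) (p : {ffun 'I_nC -> rat}) (X : {set 'I_nC}) : rat :=
  (\prod_(c in X) p c) * \prod_(c in ~: X) (1 - p c).

Definition scenario_cost (nC nF : nat) (o : {ffun 'I_nF -> rat})
  (d : {ffun 'I_nC * 'I_nF -> rat}) (phi : {ffun 'I_nC -> 'I_nF})
  (X : {set 'I_nC}) : rat :=
  \sum_(f in phi @: X) o f + \sum_(c in X) d (c, phi c).

Definition universal_cost (nC nF : nat) (o : {ffun 'I_nF -> rat})
  (d : {ffun 'I_nC * 'I_nF -> rat}) (p : {ffun 'I_nC -> rat})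
  (phi : {ffun 'I_nC -> 'I_nF}) : rat :=
  \sum_(X : {set 'I_nC}) act_prob p X * scenario_cost o d phi X.

Inductive sym := Blank | S0 | S1.
Definition sym_eqb (a b : sym) : bool :=
  match a, b with Blank, Blank | S0, S0 | S1, S1 => true | _, _ => false end.
Inductive move := MoveL | MoveR | Stay.

Record TM := {
  tm_n : nat;
  tm_start : 'I_tm_n.+1;
  tm_halt : 'I_tm_n.+1;
  tm_delta : 'I_tm_n.+1 -> sym -> 'I_tm_n.+1 * sym * move }.

(* configuration: state, left part (reversed), scanned symbol, right part *)
Record config (M : TM) := Config {
  cf_state : 'I_(tm_n M).+1;
  cf_left : seq sym;
  cf_head : sym;
  cf_right : seq sym }.

Definition tm_step (M : TM) (c : config M) : config M :=
  if cf_state c == tm_halt M then c else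
  let: (q, w, m) := tm_delta (cf_state c) (cf_head c) in
  match m with
  | Stay => Config q (cf_left c) w (cf_right c)
  | MoveL => match cf_left c with
             | [::] => Config q [::] Blank (w :: cf_right c)
             | a :: l => Config q l a (w :: cf_right c)
             end
  | MoveR => match cf_right c with
             | [::] => Config q (w :: cf_left c) Blank [::]
             | a :: r => Config q (w :: cf_left c) a r
             end
  end.

Definition sym_of_bool (b : bool) : sym := if b then S1 else S0.

Definition tm_init (M : TM) (w : seq bool) : config M :=
  match map sym_of_bool w with
  | [::] => Config (tm_start M) [::] Blank [::]
  | a :: r => Config (tm_start M) [::] a r
  end.

Definition tm_run (M : TM) (n : nat) (w : seq bool) : config M :=
  iter n (@tm_step M) (tm_init M w).

Fixpoint read_out (s : seq sym) : seq bool :=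
  match s with
  | S0 :: r => false :: read_out r
  | S1 :: r => true :: read_out r
  | _ => [::]
  end.

Definition tm_output (M : TM) (c : config M) : seq bool :=
  read_out (cf_head c :: cf_right c).

Definition halts_within (M : TM) (w : seq bool) (t : nat) (out : seq bool) :=
  exists n, (n <= t)%N /\ cf_state (tm_run M n w) = tm_halt M /\
            tm_output (tm_run M n w) = out.

Fixpoint bits_aux (fuel n : nat) : seq bool :=
  match fuel with
  | 0 => [::]
  | f.+1 => if n == 0%N then [::] else odd n :: bits_aux f n./2
  end.
Definition nat_bits (n : nat) : seq bool := bits_aux n n.

Definition enc_nat (n : nat) : seq bool :=
  flatten [seq [:: true; b] | b <- nat_bits n] ++ [:: false; false].
Definition enc_int (z : int) : seq bool := (z < 0) :: enc_nat `|z|%N.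
Definition enc_rat (q : rat) : seq bool := enc_int (numq q) ++ enc_int (denq q).

Definition enc_instance (nC nF : nat) (o : {ffun 'I_nF -> rat})
  (d : {ffun 'I_nC * 'I_nF -> rat}) (p : {ffun 'I_nC -> rat}) : seq bool :=
  enc_nat nC ++ enc_nat nF
  ++ flatten [seq enc_rat (o f) | f <- enum 'I_nF]
  ++ flatten [seq enc_rat (d (c, f)) | c <- enum 'I_nC, f <- enum 'I_nF]
  ++ flatten [seq enc_rat (p c) | c <- enum 'I_nC].

Definition enc_mapping (nC nF : nat) (phi : {ffun 'I_nC -> 'I_nF}) : seq bool :=
  flatten [seq enc_nat (nat_of_ord (phi c)) | c <- enum 'I_nC].

Definition fl_ratio : Rdefinitions.R := 4 * expR 1 / (expR 1 - 1).

(* Main.v *)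
Require Import Defs.
From mathcomp Require Import all_boot all_order all_algebra ring lra zify.
From mathcomp Require Import reals Rstruct.
From mathcomp Require Import sequences exp.
Set Implicit Arguments. Unset Strict Implicit. Unset Printing Implicit Defensive.
Import Order.TTheory GRing.Theory Num.Theory.

(** A facility [f] chosen by the clients [C] is opened with probability
    [1 - prod_C (1 - p_c)], which lies between [min(1, P) / 2] and [min(1, P)],
    where [P] is the sum of the [p_c].  Up to a factor 2 the problem is therefore a
    facility location problem with demands [p_c] in which each client may use an
    open facility, or rent any facility [g] at the additional price [o_g].  The greedy
    algorithm of Mettu and Plaxton applies: let [r_f] be the radius such that
    [sum_c p_c (r_f - d(c,f))^+ = o_f], scan the facilities by increasing radius and
    open [f] unless an open or rented facility is within [2 r_f].  Let each
    client [c] pay its connection (and rent) plus [(r_z - d(c,z))^+] for each open [z];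
    these payments cover the cost, and they are at most
    [3 max(r_f, d(c,f))] and at most [3 (o_f + d(c,f))] for every [f], which makes a
    third of them feasible for the dual program.  The total ratio is 6, and
    [6 <= 4e/(e-1)] because [e <= 3].

    Polynomial time is proved compositionally.  A single-tape machine simulates four
    stacks of bits; data are binary trees in prefix notation on the first
    stack, and the functions on such codes that are computable in polynomially many
    stack operations are closed under composition, pairing, case analysis and
    bounded iteration, which is enough to express the algorithm. *)

(** * Turing machines as composable automata *)

(** The surrogate price [min(1, P) * o_f] is the cheaper of two bills that are linear in the
    clients: buy [f] once, or charge each client [p_c * o_f]. This is where renting comes from. A
    rental of [g] behaves like an open facility that is [o_g] farther away, so the greedy rule
    treats both alike. The ratio factors as 2 times 3: the probability of opening never exceeds
    [min(1, P)], so the factor 2 is paid only once, on the side of the competing solution, and 3 is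
    the loss of the dual bound.

    The instance contains no distance between two facilities; it is replaced throughout by the
    length of a path through a client. Radii exist only if some client has positive probability;
    otherwise every mapping costs 0.

    For the running time, the program computes with natural numbers, all data being multiplied by
    the product of all denominators, which has polynomial length. The machine has to keep its bound
    on every nonempty word, not only on encoded instances, and repeated application of a
    polynomial-time function can produce long data; hence the truncated ranges and the separate size
    bound for each loop. *)

Definition tape := (seq sym * sym * seq sym)%type.

Definition write_move (t : tape) (a : sym) (m : move) : tape :=
  let: (l, _, r) := t in
  match m with
  | Stay => (l, a, r)
  | MoveL => if l is b :: l' then (l', b, a :: r) else ([::], Blank, a :: r)
  | MoveR => if r is b :: r' then (a :: l, b, r') else (a :: l, Blank, [::])
  end.

(** Unlike a [TM], an automaton leaves with a value of type [E], on which the next program can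
    branch; a single halting state appears only in [tm_of]. *)
Record autom (E : Type) := Autom {
  state : finType;
  init : state;
  exit : state -> option E;
  delta : state -> sym -> state * sym * move }.

Section Steps.
Variables (E : Type) (A : autom E).

Definition astep (c : state A * tape) : state A * tape :=
  let: (q, a, m) := delta c.1 c.2.1.2 in (q, write_move c.2 a m).

Fixpoint steps (n : nat) (c c' : state A * tape) : Prop :=
  if n is n'.+1 then exit c.1 = None /\ steps n' (astep c) c' else c = c'.

Lemma steps_cat m n c1 c2 c3 :
  steps m c1 c2 -> steps n c2 c3 -> steps (m + n) c1 c3.
Proof.
elim: m c1 => [|m IH] c1 /=; first by move=> ->.
by case=> e1 s12 s23; split=> //; apply: IH.
Qed.

Definition runs (t : tape) (N : nat) (e : E) (t' : tape) : Prop :=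
  exists n q, [/\ n <= N, steps n (init A, t) (q, t') & exit q = Some e].

Lemma runs_le t N N' e t' : runs t N e t' -> N <= N' -> runs t N' e t'.
Proof.
by move=> [n [q [nN s ex]]] NN'; exists n, q; split=> //; exact: leq_trans NN'.
Qed.
End Steps.

Definition ret (E : Type) (e : E) : autom E :=
  {| state := unit; init := tt; exit := fun=> Some e;
     delta := fun q a => (q, a, Stay) |}.

Lemma runs_ret (E : Type) (e : E) t : runs (ret e) t 0 e t.
Proof. by exists 0, tt. Qed.

Definition act (E : finType) (f : sym -> sym * move * E) : autom E :=
  {| state := option E; init := None; exit := id;
     delta := fun q a => if q is Some _ then (q, a, Stay)
                         else let: (b, m, e) := f a in (Some e, b, m) |}.

Lemma runs_act (E : finType) (f : sym -> sym * move * E) t :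
  runs (act f) t 1 (f t.1.2).2 (write_move t (f t.1.2).1.1 (f t.1.2).1.2).
Proof.
exists 1, (Some (f t.1.2).2); split=> //=; split=> //.
by rewrite /astep /=; case: (f t.1.2) => [[b m] e].
Qed.

Section Bind.
Variables (E : finType) (F : Type) (A : autom E) (B : E -> autom F).

(** The second machine depends on the exit value, hence the dependent sum of states. Entering it
    costs one idle step, the successor in [runs_bind]. *)
Definition bind : autom F :=
  {| state := (state A + {e : E & state (B e)})%type;
     init := inl (init A);
     exit := fun q => match q with
                      | inl _ => None
                      | inr (existT e q) => exit q
                      end;
     delta := fun q a => match q with
       | inl q => match exit q with
                  | Some e => (inr (existT _ e (init (B e))), a, Stay)
                  | None => let: (q', b, m) := delta q a in (inl q', b, m)
                  end
       | inr (existT e q) =>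
           let: (q', b, m) := delta q a in (inr (existT _ e q'), b, m)
       end |}.

Lemma bind_stepsl n q t q' t' : steps (A := A) n (q, t) (q', t') ->
  steps (A := bind) n (inl q, t) (inl q', t').
Proof.
elim: n q t => [|n IH] q t /=; first by case=> -> ->.
case=> ex; rewrite /astep /= ex.
by case: (delta _ _) => [[q1 b] m] /= /IH.
Qed.

Lemma bind_stepsr n e q t q' t' : steps (A := B e) n (q, t) (q', t') ->
  steps (A := bind) n (inr (existT _ e q), t) (inr (existT _ e q'), t').
Proof.
elim: n q t => [|n IH] q t /=; first by case=> -> ->.
case=> ex; rewrite /astep /= ex.
by case: (delta _ _) => [[q1 b] m] /= /IH.
Qed.

Lemma runs_bind t N e t' M f t'' :
  runs A t N e t' -> runs (B e) t' M f t'' -> runs bind t (N + M).+1 f t''.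
Proof.
move=> [n [q [nN s ex]]] [m [q' [mM s' ex']]].
exists (n + m.+1), (inr (existT _ e q')); split=> //; first by lia.
apply: steps_cat (bind_stepsl s) _.
split=> //; rewrite /astep /= ex /=.
have -> : write_move t' t'.1.2 Stay = t' by case: (t') => [[]].
exact: bind_stepsr.
Qed.
End Bind.

(* A loop carrying a finite memory [s : S]; [inl] restarts the body with a new
   memory, [inr] leaves the loop. *)
Section Loop.
Variables (S E : finType) (A : S -> autom (S + E)%type).

Definition loop (s : S) : autom E :=
  {| state := {s : S & state (A s)};
     init := existT _ s (init (A s));
     exit := fun q => let: existT s q := q in
                      if exit q is Some (inr e) then Some e else None;
     delta := fun q a => let: existT s q := q in
        match exit q with
        | Some (inl s') => (existT _ s' (init (A s')), a, Stay)
        | _ => let: (q', b, m) := delta q a in (existT _ s q', b, m)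
        end |}.

Lemma loop_steps s0 n s q t q' t' : steps (A := A s) n (q, t) (q', t') ->
  steps (A := loop s0) n (existT _ s q, t) (existT _ s q', t').
Proof.
elim: n q t => [|n IH] q t /=; first by case=> -> ->.
case=> ex; rewrite /astep /= ex.
by case: (delta _ _) => [[q1 b] m] /= /IH.
Qed.

(** The argument of [loop] fixes only the initial state, so a run can be continued by one that was
    started with another memory. *)
Lemma loop_steps_init s0 s1 n c c' :
  steps (A := loop s0) n c c' -> steps (A := loop s1) n c c'.
Proof. by elim: n c => [|n IH] c //= [? /IH]. Qed.

Lemma runs_loop_end s t N e t' :
  runs (A s) t N (inr e) t' -> runs (loop s) t N e t'.
Proof.
move=> [n [q [nN st ex]]]; exists n, (existT _ s q); split=> //=.
  exact: loop_steps.
by rewrite ex.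
Qed.

Lemma runs_loop_next s t N s' t' M e t'' :
  runs (A s) t N (inl s') t' -> runs (loop s') t' M e t'' ->
  runs (loop s) t (N + M).+1 e t''.
Proof.
move=> [n [q [nN st ex]]] [m [q' [mM st' ex']]].
exists (n + m.+1), q'; split=> //; first by lia.
apply: steps_cat (loop_steps s st) _; split; first by rewrite /= ex.
rewrite /astep /= ex /=.
have -> : write_move t' t'.1.2 Stay = t' by case: (t') => [[]].
exact: loop_steps_init st'.
Qed.
End Loop.

Section ToTM.
Variables (E : Type) (A : autom E).
Let T : finType := option (state A).

Lemma card_states : (#|T|.-1).+1 = #|T|.
Proof. by rewrite prednK //; apply/card_gt0P; exists None. Qed.

Definition to_ord (q : T) : 'I_(#|T|.-1).+1 :=
  cast_ord (esym card_states) (enum_rank q).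
Definition of_ord (i : 'I_(#|T|.-1).+1) : T := enum_val (cast_ord card_states i).

Lemma to_ordK q : of_ord (to_ord q) = q.
Proof. by rewrite /of_ord /to_ord cast_ordKV enum_rankK. Qed.

Definition tm_of : TM :=
  {| tm_n := #|T|.-1;
     tm_start := to_ord (Some (init A));
     tm_halt := to_ord None;
     tm_delta := fun i a =>
       if of_ord i is Some q then
         if exit q is Some _ then (to_ord None, a, Stay)
         else let: (q', b, m) := delta q a in (to_ord (Some q'), b, m)
       else (i, a, Stay) |}.

Definition conf (q : T) (t : tape) : config tm_of :=
  @Config tm_of (to_ord q) t.1.1 t.1.2 t.2.

Lemma to_ord_halt q : (to_ord (Some q) == to_ord None) = false.
Proof. by apply/eqP => /(congr1 of_ord); rewrite !to_ordK. Qed.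

Lemma tm_of_steps n q t q' t' : steps (A := A) n (q, t) (q', t') ->
  iter n (@tm_step tm_of) (conf (Some q) t) = conf (Some q') t'.
Proof.
elim: n q t => [|n IH] q t; first by move=> /= [-> ->].
rewrite iterSr /= => -[ex]; rewrite /astep /=.
case E1: (delta _ _) => [[q1 b] m] /= /IH <-; congr iter.
rewrite /tm_step /= to_ord_halt to_ordK ex E1.
by case: t {E1} => [[l h] r] /=; case: m => //=; [case: l | case: r].
Qed.

Lemma runs_tm w N e t' :
  runs A ([::], head Blank (map sym_of_bool w), behead (map sym_of_bool w)) N e t' ->
  halts_within tm_of w N.+1 (read_out (t'.1.2 :: t'.2)).
Proof.
move=> [n [q [nN st ex]]]; exists n.+1; split=> //.
have -> : tm_run tm_of n.+1 w = conf None t'.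
  rewrite /tm_run iterS.
  have -> : tm_init tm_of w = conf (Some (init A))
    ([::], head Blank (map sym_of_bool w), behead (map sym_of_bool w)).
    by rewrite /tm_init; case: map.
  by rewrite (tm_of_steps st) /tm_step /= to_ord_halt to_ordK ex.
by [].
Qed.
End ToTM.

(** * Stacks on a tape *)

Notation msym := (map sym_of_bool).
Definition symo (o : option bool) : sym := if o is Some b then sym_of_bool b else Blank.
Definition bit_of (a : sym) : option bool :=
  match a with Blank => None | S0 => Some false | S1 => Some true end.

Lemma bit_of_sym b : bit_of (sym_of_bool b) = Some b. Proof. by case: b. Qed.

(** Two views of a tape cut between [l] and [w]: the head is on the first cell of [w] in [stream],
    on the nearest cell of [l] in [lstream]. The default [Blank] makes running off either end
    harmless. *)
Definition stream (l w : seq sym) : tape := (l, head Blank w, behead w).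
Definition lstream (l w : seq sym) : tape := (behead l, head Blank l, w).

Lemma stream_moveR l a w b : write_move (stream l (a :: w)) b MoveR = stream (b :: l) w.
Proof. by case: w. Qed.
Lemma stream_moveL l a w b : write_move (stream l (a :: w)) b MoveL = lstream l (b :: w).
Proof. by case: l. Qed.
Lemma lstream_moveL a l w b : write_move (lstream (a :: l) w) b MoveL = lstream l (b :: w).
Proof. by case: l. Qed.

Lemma runs_act_eq (E : finType) (f : sym -> sym * move * E) t a b m e t' :
  t.1.2 = a -> f a = (b, m, e) -> write_move t b m = t' -> runs (act f) t 1 e t'.
Proof. by move=> ta fa <-; have := runs_act f t; rewrite ta fa. Qed.

Fixpoint rep (n : nat) (A : autom unit) : autom unit :=
  if n is n'.+1 then bind A (fun=> rep n' A) else ret tt.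

Definition go (m : move) : autom unit := act (fun a => (a, m, tt)).

Lemma runs_goR l a w : runs (go MoveR) (stream l (a :: w)) 1 tt (stream (a :: l) w).
Proof. by apply: runs_act_eq; [| | exact: stream_moveR]. Qed.
Lemma runs_goL l a w : runs (go MoveL) (stream l (a :: w)) 1 tt (lstream l (a :: w)).
Proof. by apply: runs_act_eq; [| | exact: stream_moveL]. Qed.

Definition scan (m : move) : autom unit :=
  loop (fun _ : unit => act (fun a =>
    if a is Blank then (a, Stay, inr tt) else (a, m, inl tt))) tt.

Lemma runs_scanR x l r :
  runs (scan MoveR) (stream l (msym x ++ Blank :: r)) (2 * size x + 1) tt
       (stream (rev (msym x) ++ l) (Blank :: r)).
Proof.
elim: x l => [|b x IH] l /=.
  by apply: runs_loop_end; apply: runs_act_eq.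
have := IH (sym_of_bool b :: l).
rewrite rev_cons cat_rcons => H.
apply: runs_le; first apply: runs_loop_next H.
- apply: (@runs_act_eq _ _ _ (sym_of_bool b)); first by [].
  + by case: (b).
  + exact: stream_moveR.
- by lia.
Qed.

Lemma runs_scanL x l r :
  runs (scan MoveL) (lstream (msym x ++ Blank :: l) r) (2 * size x + 1) tt
       (lstream (Blank :: l) (rev (msym x) ++ r)).
Proof.
elim: x r => [|b x IH] r /=.
  by apply: runs_loop_end; apply: runs_act_eq.
have := IH (sym_of_bool b :: r).
rewrite rev_cons cat_rcons => H.
apply: runs_le; first apply: runs_loop_next H.
- apply: (@runs_act_eq _ _ _ (sym_of_bool b)); first by [].
  + by case: (b).
  + exact: lstream_moveL.
- by lia.
Qed.

Definition skip (m : move) : autom unit := bind (go m) (fun=> scan m).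

Lemma runs_skipR x l r :
  runs (skip MoveR) (stream l (Blank :: msym x ++ Blank :: r)) (2 * size x + 3) tt
       (stream (rev (msym x) ++ Blank :: l) (Blank :: r)).
Proof.
apply: runs_le; first apply: runs_bind.
- exact: runs_goR.
- exact: runs_scanR.
- by lia.
Qed.

Lemma runs_skipL x l r :
  runs (skip MoveL) (stream (rev (msym x) ++ Blank :: l) (Blank :: r)) (2 * size x + 3) tt
       (stream l (Blank :: msym x ++ Blank :: r)).
Proof.
have := runs_scanL (rev x) l (Blank :: r).
rewrite map_rev revK size_rev => H.
apply: runs_le; first apply: runs_bind.
- exact: runs_goL.
- exact: H.
- by lia.
Qed.

Definition body (s : seq (seq bool)) : seq sym :=
  flatten [seq msym x ++ [:: Blank] | x <- s].
(** The left part of the tape, nearest cell first, once the head has moved from the separator before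
    the stacks [s] to the one behind them. *)
Definition past (l : seq sym) (s : seq (seq bool)) : seq sym :=
  foldl (fun l x => rev (msym x) ++ Blank :: l) l s.
Definition tot (s : seq (seq bool)) : nat := sumn (map size s).

Lemma body_cons x s r : body (x :: s) ++ r = msym x ++ Blank :: body s ++ r.
Proof. by rewrite /body /= -!catA. Qed.

Lemma body_cat s1 s2 : body (s1 ++ s2) = body s1 ++ body s2.
Proof. by rewrite /body map_cat flatten_cat. Qed.

Lemma body_rcons s x r : body (s ++ [:: x]) ++ r = body s ++ msym x ++ Blank :: r.
Proof. by rewrite body_cat -catA body_cons. Qed.

Lemma tot_cat s1 s2 : tot (s1 ++ s2) = tot s1 + tot s2.
Proof. by rewrite /tot map_cat sumn_cat. Qed.

Lemma runs_skipsR s l r :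
  runs (rep (size s) (skip MoveR)) (stream l (Blank :: body s ++ r))
    (2 * tot s + 4 * size s) tt (stream (past l s) (Blank :: r)).
Proof.
elim: s l => [|x s IH] l; first exact: runs_ret.
rewrite body_cons /=.
apply: runs_le; first apply: runs_bind (runs_skipR _ _ _) (IH _).
by rewrite /tot /=; lia.
Qed.

Lemma runs_skipsL s l r :
  runs (rep (size s) (skip MoveL)) (stream (past l s) (Blank :: r))
    (2 * tot s + 4 * size s) tt (stream l (Blank :: body s ++ r)).
Proof.
elim/last_ind: s r => [|s x IH] r; first exact: runs_ret.
rewrite size_rcons /past -cats1 foldl_cat /= -/(past l s).
apply: runs_le; first apply: runs_bind (runs_skipL _ _ _) _.
  by have := IH (msym x ++ Blank :: r); rewrite -body_rcons; apply.
by rewrite tot_cat /tot /=; lia.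
Qed.

(** The memory holds the symbol just overwritten, to be written one cell further right. The
    separator that ends the segment is swallowed; starting the next segment with [None] writes it
    back. *)
Definition shiftR : option bool -> autom unit :=
  loop (fun c => act (fun a =>
    (symo c, MoveR, if bit_of a is Some b then inl (Some b) else inr tt))).

Lemma runs_shiftR c x l r :
  runs (shiftR c) (stream l (msym x ++ Blank :: r)) (2 * size x + 1) tt
       (stream (rev (symo c :: msym x) ++ l) r).
Proof.
rewrite /shiftR; elim: x c l => [|b x IH] c l /=.
  apply: runs_loop_end; apply: runs_act_eq => //; exact: stream_moveR.
have H := IH (Some b) (symo c :: l); rewrite rev_cons cat_rcons.
apply: runs_le; first apply: runs_loop_next H.
- apply: (@runs_act_eq _ _ _ (sym_of_bool b)); first by [].
  + by rewrite bit_of_sym.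
  + exact: stream_moveR.
- by lia.
Qed.

Lemma runs_shiftsR s l r :
  runs (rep (size s) (shiftR None)) (stream l (body s ++ r))
    (2 * tot s + 2 * size s) tt (stream (past l s) r).
Proof.
elim: s l => [|x s IH] l; first exact: runs_ret.
rewrite body_cons /=.
apply: runs_le; first apply: runs_bind (runs_shiftR _ _ _ _) _.
  by rewrite rev_cons cat_rcons; exact: IH.
by rewrite /tot /=; lia.
Qed.

(* [push_at i j b] pushes [b] on the stack that has [i] stacks before it and
   [j] after it, starting and ending on the leftmost separator. *)
Definition push_at (i j : nat) (b : bool) : autom unit :=
  bind (rep i (skip MoveR)) (fun=> bind (go MoveR) (fun=>
  bind (shiftR (Some b)) (fun=> bind (rep j (shiftR None)) (fun=>
  bind (act (fun=> (Blank, Stay, tt))) (fun=> rep (i + j.+1) (skip MoveL)))))).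

Lemma runs_push s1 x s2 b r :
  runs (push_at (size s1) (size s2) b)
    (stream [::] (Blank :: body (s1 ++ x :: s2) ++ r))
    (6 * (tot (s1 ++ x :: s2)) + 20 * size (s1 ++ x :: s2) + 20) tt
    (stream [::] (Blank :: body (s1 ++ (b :: x) :: s2) ++ behead r)).
Proof.
rewrite body_cat -catA body_cons.
apply: runs_le.
apply: runs_bind (runs_skipsR _ _ _) _.
apply: runs_bind.
  exact: runs_goR.
apply: runs_bind (runs_shiftR _ _ _ _) _.
apply: runs_bind (runs_shiftsR _ _ _) _.
apply: runs_bind.
  (* The separator swallowed last is written on the first cell of [r], hence [behead r]. *)
  apply: (@runs_act_eq _ _ _ (head Blank r) Blank Stay tt (stream _ (Blank :: behead r))) => //.
have := runs_skipsL (s1 ++ (b :: x) :: s2) [::] (behead r).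
rewrite size_cat /= /past foldl_cat /=.
by rewrite !rev_cons !cat_rcons; apply.
rewrite !tot_cat /tot size_cat /=; lia.
Qed.

Definition shiftL : option bool -> autom (option bool) :=
  loop (fun c => act (fun a =>
    if bit_of a is Some b then (symo c, MoveL, inl (Some b)) else (a, Stay, inr c))).

(* Deleting a cell to the left moves the carried symbol in front of [x]: the
   machine leaves with the first symbol of [x ++ c] still to be written. *)
Lemma runs_shiftL c x l w :
  exists e w', symo e :: w' = msym x ++ symo c :: w /\
  runs (shiftL c) (lstream (rev (msym x) ++ Blank :: l) w) (2 * size x + 1) e
       (lstream (Blank :: l) w').
Proof.
rewrite /shiftL; elim/last_ind: x c w => [|x b IH] c w.
  by exists c, w; split=> //; apply: runs_loop_end; apply: runs_act_eq.
have [e [w' [ew H]]] := IH (Some b) (symo c :: w); exists e, w'; split.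
  by rewrite ew map_rcons cat_rcons.
rewrite map_rcons rev_rcons /= size_rcons.
apply: runs_le; first apply: runs_loop_next H.
- apply: (@runs_act_eq _ _ _ (sym_of_bool b)); first by [].
  + by rewrite bit_of_sym.
  + exact: lstream_moveL.
- by lia.
Qed.

Definition shift_segL : autom unit :=
  bind (shiftL None) (fun e => act (fun=> (symo e, MoveL, tt))).

Lemma runs_shift_segL x l w :
  runs shift_segL (lstream (rev (msym x) ++ Blank :: l) w) (2 * size x + 3) tt
       (lstream l (msym x ++ Blank :: w)).
Proof.
have [e [w' [ew H]]] := runs_shiftL None x l w.
apply: runs_le; first apply: runs_bind H _.
  by apply: runs_act_eq => //; rewrite lstream_moveL ew.
by lia.
Qed.

Lemma runs_shift_segsL s l w :
  runs (rep (size s) shift_segL) (lstream (past l s) w) (2 * tot s + 4 * size s) tt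
       (lstream l (body s ++ w)).
Proof.
elim/last_ind: s w => [|s x IH] w; first exact: runs_ret.
rewrite size_rcons /past -cats1 foldl_cat /= -/(past l s).
apply: runs_le; first apply: runs_bind (runs_shift_segL _ _ _) _.
  by have := IH (msym x ++ Blank :: w); rewrite -body_rcons; apply.
by rewrite tot_cat /tot /=; lia.
Qed.

Definition pop_at (i j : nat) : autom unit :=
  bind (rep (i + j.+1) (skip MoveR)) (fun=> bind (go MoveL) (fun=>
  bind (rep j shift_segL) (fun=> bind (shiftL None) (fun=> rep i (skip MoveL))))).

Lemma runs_pop s1 b x s2 r :
  runs (pop_at (size s1) (size s2))
    (stream [::] (Blank :: body (s1 ++ (b :: x) :: s2) ++ r))
    (6 * (tot (s1 ++ (b :: x) :: s2)) + 20 * size (s1 ++ (b :: x) :: s2) + 20) tt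
    (stream [::] (Blank :: body (s1 ++ x :: s2) ++ Blank :: r)).
Proof.
apply: runs_le.
apply: runs_bind.
  have := runs_skipsR (s1 ++ (b :: x) :: s2) [::] r.
  by rewrite size_cat /= /past foldl_cat /=; apply.
apply: runs_bind.
  exact: runs_goL.
apply: runs_bind (runs_shift_segsL _ _ _) _.
have [e [w' [ew H]]] := runs_shiftL None (b :: x) (past [::] s1) (body s2 ++ Blank :: r).
(* The symbol [e] still in the memory is the popped bit; leaving it unwritten is what deletes it. *)
case: ew => _ ew.
apply: runs_bind H _.
have := runs_skipsL s1 [::] w'.
by rewrite ew body_cat -catA body_cons; apply.
rewrite !tot_cat /tot size_cat /=; lia.
Qed.

Definition top_at (i : nat) : autom (option bool) :=
  bind (rep i (skip MoveR)) (fun=> bind (go MoveR) (fun=>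
  bind (act (fun a => (a, MoveL, bit_of a))) (fun o =>
  bind (rep i (skip MoveL)) (fun=> ret o)))).

Lemma runs_top s1 x s2 r :
  runs (top_at (size s1))
    (stream [::] (Blank :: body (s1 ++ x :: s2) ++ r))
    (6 * (tot (s1 ++ x :: s2)) + 20 * size (s1 ++ x :: s2) + 20) (ohead x)
    (stream [::] (Blank :: body (s1 ++ x :: s2) ++ r)).
Proof.
rewrite body_cat -catA body_cons.
apply: runs_le.
apply: runs_bind (runs_skipsR _ _ _) _.
apply: runs_bind.
  exact: runs_goR.
apply: (@runs_bind _ _ _ _ _ 1 (ohead x) (stream (past [::] s1)
  (Blank :: msym x ++ Blank :: body s2 ++ r))).
  case: x => [|b x] /=.
    by apply: (@runs_act_eq _ _ _ Blank).
  apply: (@runs_act_eq _ _ _ (sym_of_bool b) (sym_of_bool b) MoveL) => //.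
  by rewrite bit_of_sym.
apply: runs_bind; [exact: runs_skipsL | exact: runs_ret].
rewrite !tot_cat /tot size_cat /=; lia.
Qed.

Definition popc_at (i j : nat) : autom (option bool) :=
  bind (top_at i) (fun o => if o is Some b then bind (pop_at i j) (fun=> ret o) else ret o).

(** Removing a bit leaves one more blank at the right end, popping an empty stack leaves the tape as
    it is; [srepr] allows for both by its arbitrary number of trailing blanks. *)
Lemma runs_popc s1 x s2 r :
  exists r', (r' = r \/ r' = Blank :: r) /\
  runs (popc_at (size s1) (size s2))
    (stream [::] (Blank :: body (s1 ++ x :: s2) ++ r))
    (12 * (tot (s1 ++ x :: s2)) + 40 * size (s1 ++ x :: s2) + 45) (ohead x)
    (stream [::] (Blank :: body (s1 ++ behead x :: s2) ++ r')).
Proof.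
case: x => [|b x].
  exists r; split; first by left.
  apply: runs_le; first by apply: runs_bind; [exact: runs_top | exact: runs_ret].
  by lia.
exists (Blank :: r); split; first by right.
apply: runs_le; first apply: runs_bind; first exact: runs_top.
  by apply: runs_bind; [exact: runs_pop | exact: runs_ret].
by lia.
Qed.

Definition stacks : Type := (seq bool * seq bool * seq bool * seq bool)%type.
Definition seq_of_stacks (s : stacks) : seq (seq bool) :=
  let: (a, b, c, d) := s in [:: a; b; c; d].
Definition ssize (s : stacks) : nat := tot (seq_of_stacks s).
(* The stacks lie on the tape from left to right, tops on the left, each one preceded by
   a blank; the head is on the first blank. *)
Definition srepr (s : stacks) (t : tape) : Prop :=
  exists m, t = stream [::] (Blank :: body (seq_of_stacks s) ++ nseq m Blank).

(* [sruns A s T e s']: [A] acts as a program performing [T] stack operations.  Since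
   [0 < T], the bound [T * (ssize s + T)] is strictly superadditive along a sequence of
   programs, which absorbs the steps taken to enter the next one. *)
Definition sruns (E : Type) (A : autom E) (s : stacks) (T : nat) (e : E) (s' : stacks) :=
  [/\ 0 < T, ssize s' <= ssize s + T &
      forall t, srepr s t -> exists2 t', srepr s' t' &
        runs A t (300 * (T * (ssize s + T))) e t'].

Lemma sruns_le (E : Type) (A : autom E) s T T' e s' :
  sruns A s T e s' -> T <= T' -> sruns A s T' e s'.
Proof.
move=> [T0 szs H] TT'; split; [lia | lia |].
move=> t /H[t' rt' rn]; exists t' => //; apply: runs_le rn _.
by rewrite leq_mul2l leq_mul //; lia.
Qed.

Lemma sruns_ret (E : Type) (e : E) s : sruns (ret e) s 1 e s.
Proof.
split=> //; first by lia.
by move=> t rt; exists t => //; apply: runs_le (runs_ret _ _) _.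
Qed.

Lemma sruns_bind (E : finType) (F : Type) (A : autom E) (B : E -> autom F) s T e s' U f s'' :
  sruns A s T e s' -> sruns (B e) s' U f s'' -> sruns (bind A B) s (T + U) f s''.
Proof.
move=> [T0 sz1 H1] [U0 sz2 H2]; split; [lia | lia |].
move=> t /H1[t' /H2[t'' rt'' r2] r1]; exists t'' => //.
apply: runs_le (runs_bind r1 r2) _; nia.
Qed.

Lemma sruns_loop_end (S E : finType) (A : S -> autom (S + E)%type) m s T e s' :
  sruns (A m) s T (inr e) s' -> sruns (loop A m) s T e s'.
Proof.
move=> [T0 sz1 H1]; split=> //.
by move=> t /H1[t' rt' r1]; exists t' => //; exact: runs_loop_end.
Qed.

Lemma sruns_loop_next (S E : finType) (A : S -> autom (S + E)%type) m s T m' s' U e s'' :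
  sruns (A m) s T (inl m') s' -> sruns (loop A m') s' U e s'' ->
  sruns (loop A m) s (T + U) e s''.
Proof.
move=> [T0 sz1 H1] [U0 sz2 H2]; split; [lia | lia |].
move=> t /H1[t' /H2[t'' rt'' r2] r1]; exists t'' => //.
apply: runs_le (runs_loop_next r1 r2) _; nia.
Qed.

Definition push0 b := push_at 0 3 b.
Definition push1 b := push_at 1 2 b.
Definition push2 b := push_at 2 1 b.
Definition push3 b := push_at 3 0 b.
Definition pop0 := popc_at 0 3.
Definition pop1 := popc_at 1 2.
Definition pop2 := popc_at 2 1.
Definition pop3 := popc_at 3 0.

Lemma push_srepr (s1 s2 : seq (seq bool)) x b (s s' : stacks) :
  seq_of_stacks s = s1 ++ x :: s2 -> seq_of_stacks s' = s1 ++ (b :: x) :: s2 ->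
  sruns (push_at (size s1) (size s2) b) s 1 tt s'.
Proof.
move=> es es'; split=> //.
  by rewrite /ssize es es' !tot_cat /tot /=; lia.
move=> t [m ->].
have H := runs_push s1 x s2 b (nseq m Blank).
exists (stream [::] (Blank :: body (s1 ++ (b :: x) :: s2) ++ behead (nseq m Blank))).
  by exists m.-1; rewrite es'; case: (m).
rewrite es; apply: runs_le H _; rewrite /ssize es.
have -> : size (s1 ++ x :: s2) = 4 by rewrite -es; case: (s) => [[[]]].
lia.
Qed.

Lemma pop_srepr (s1 s2 : seq (seq bool)) x (s s' : stacks) :
  seq_of_stacks s = s1 ++ x :: s2 -> seq_of_stacks s' = s1 ++ behead x :: s2 ->
  sruns (popc_at (size s1) (size s2)) s 1 (ohead x) s'.
Proof.
move=> es es'; split=> //.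
  by rewrite /ssize es es' !tot_cat /tot /= size_behead; lia.
move=> t [m ->].
have [r' [er' H]] := runs_popc s1 x s2 (nseq m Blank).
exists (stream [::] (Blank :: body (s1 ++ (behead x) :: s2) ++ r')).
  by rewrite /srepr es'; case: er' => ->; [exists m | exists m.+1].
rewrite es; apply: runs_le H _; rewrite /ssize es.
have -> : size (s1 ++ x :: s2) = 4 by rewrite -es; case: (s) => [[[]]].
lia.
Qed.

Section StackOps.
Variables (x y z u : seq bool) (b : bool).
Lemma sruns_push0 : sruns (push0 b) (x, y, z, u) 1 tt (b :: x, y, z, u).
Proof. exact: (@push_srepr [::] [:: y; z; u] x). Qed.
Lemma sruns_push1 : sruns (push1 b) (x, y, z, u) 1 tt (x, b :: y, z, u).
Proof. exact: (@push_srepr [:: x] [:: z; u] y). Qed.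
Lemma sruns_push2 : sruns (push2 b) (x, y, z, u) 1 tt (x, y, b :: z, u).
Proof. exact: (@push_srepr [:: x; y] [:: u] z). Qed.
Lemma sruns_push3 : sruns (push3 b) (x, y, z, u) 1 tt (x, y, z, b :: u).
Proof. exact: (@push_srepr [:: x; y; z] [::] u). Qed.
Lemma sruns_pop0 : sruns pop0 (x, y, z, u) 1 (ohead x) (behead x, y, z, u).
Proof. exact: (@pop_srepr [::] [:: y; z; u] x). Qed.
Lemma sruns_pop1 : sruns pop1 (x, y, z, u) 1 (ohead y) (x, behead y, z, u).
Proof. exact: (@pop_srepr [:: x] [:: z; u] y). Qed.
Lemma sruns_pop2 : sruns pop2 (x, y, z, u) 1 (ohead z) (x, y, behead z, u).
Proof. exact: (@pop_srepr [:: x; y] [:: u] z). Qed.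
Lemma sruns_pop3 : sruns pop3 (x, y, z, u) 1 (ohead u) (x, y, z, behead u).
Proof. exact: (@pop_srepr [:: x; y; z] [::] u). Qed.
End StackOps.

(** * Polynomial-time functions *)

Global Opaque push0 push1 push2 push3 pop0 pop1 pop2 pop3.

Inductive tree := Nil | Cons of tree & tree.

Fixpoint ser (t : tree) : seq bool :=
  if t is Cons a b then true :: ser a ++ ser b else [:: false].

Definition while (A : autom bool) : autom unit :=
  loop (fun _ : unit => bind A (fun b => ret (if b then inl tt else inr tt))) tt.

Lemma sruns_while_next A s T s' U s'' :
  sruns A s T true s' -> sruns (while A) s' U tt s'' -> sruns (while A) s (T + 1 + U) tt s''.
Proof.
move=> H1 H2; apply: sruns_loop_next H2; apply: sruns_bind H1 _; exact: sruns_ret.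
Qed.

Lemma sruns_while_end A s T s' :
  sruns A s T false s' -> sruns (while A) s (T + 1) tt s'.
Proof.
move=> H1; apply: sruns_loop_end; apply: sruns_bind H1 _; exact: sruns_ret.
Qed.

(** The common pattern of loops that empty one stack: [st w a] are the stacks with [w] still to be
    read, and [upd] is the effect of one bit on the others. *)
Lemma sruns_drain (X : Type) (st : seq bool -> X -> stacks) (upd : X -> bool -> X) A T :
  (forall b w a, sruns A (st (b :: w) a) T true (st w (upd a b))) ->
  (forall a, sruns A (st [::] a) T false (st [::] a)) ->
  forall w a, sruns (while A) (st w a) (T.+1 * (size w).+1) tt (st [::] (foldl upd a w)).
Proof.
move=> Hs H0; elim=> [|b w IH] a.
  by apply: sruns_le (sruns_while_end (H0 a)) _; lia.
apply: sruns_le (sruns_while_next (Hs b w a) (IH _)) _; rewrite /=; lia.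
Qed.

Notation "A ;; B" := (bind A (fun=> B)) (at level 60, right associativity).

Definition pour10 : autom unit := while (bind pop1 (fun o =>
  if o is Some b then push0 b ;; ret true else ret false)).
Definition pour20 : autom unit := while (bind pop2 (fun o =>
  if o is Some b then push0 b ;; ret true else ret false)).
Definition pour21 : autom unit := while (bind pop2 (fun o =>
  if o is Some b then push1 b ;; ret true else ret false)).
Definition pour102 : autom unit := while (bind pop1 (fun o =>
  if o is Some b then push0 b ;; push2 b ;; ret true else ret false)).

Lemma catrev_foldl (T : Type) (x w : seq T) : foldl (fun a b => b :: a) x w = rev w ++ x.
Proof. by elim: w x => [|b w IH] x //=; rewrite IH rev_cons cat_rcons. Qed.

Ltac srun := simpl; lazymatch goal with
  | |- sruns (bind _ _) _ _ _ _ => eapply sruns_bind; [srun | srun]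
  | |- sruns (ret _) _ _ _ _ => exact: sruns_ret
  | |- sruns (push0 _) _ _ _ _ => exact: sruns_push0
  | |- sruns (push1 _) _ _ _ _ => exact: sruns_push1
  | |- sruns (push2 _) _ _ _ _ => exact: sruns_push2
  | |- sruns (push3 _) _ _ _ _ => exact: sruns_push3
  | |- sruns pop0 _ _ _ _ => exact: sruns_pop0
  | |- sruns pop1 _ _ _ _ => exact: sruns_pop1
  | |- sruns pop2 _ _ _ _ => exact: sruns_pop2
  | |- sruns pop3 _ _ _ _ => exact: sruns_pop3
  end.
Ltac srun_le := eapply sruns_le; [srun | by rewrite /=; lia].

Lemma sruns_pour10 x y z u :
  sruns pour10 (x, y, z, u) (5 * (size y).+1) tt (rev y ++ x, [::], z, u).
Proof.
have := @sruns_drain _ (fun w x => (x, w, z, u)) (fun a b => b :: a) _ 4 _ _ y x.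
by rewrite catrev_foldl; apply=> *; srun_le.
Qed.

Lemma sruns_pour20 x y z u :
  sruns pour20 (x, y, z, u) (5 * (size z).+1) tt (rev z ++ x, y, [::], u).
Proof.
have := @sruns_drain _ (fun w x => (x, y, w, u)) (fun a b => b :: a) _ 4 _ _ z x.
by rewrite catrev_foldl; apply=> *; srun_le.
Qed.

Lemma sruns_pour21 x y z u :
  sruns pour21 (x, y, z, u) (5 * (size z).+1) tt (x, rev z ++ y, [::], u).
Proof.
have := @sruns_drain _ (fun w y => (x, y, w, u)) (fun a b => b :: a) _ 4 _ _ z y.
by rewrite catrev_foldl; apply=> *; srun_le.
Qed.

Lemma sruns_pour102 x y z u :
  sruns pour102 (x, y, z, u) (5 * (size y).+1) tt (rev y ++ x, [::], rev y ++ z, u).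
Proof.
have := @sruns_drain _ (fun w (a : seq bool * seq bool) => (a.1, w, a.2, u))
   (fun a b => (b :: a.1, b :: a.2)) _ 4 _ _ y (x, z).
have -> : foldl (fun a b => (b :: a.1, b :: a.2)) (x, z) y = (rev y ++ x, rev y ++ z).
  by elim: y x z => [|b y IH] x z //=; rewrite IH rev_cons !cat_rcons.
by apply=> *; srun_le.
Qed.

(* Stack 3 holds in unary the number of subtrees that remain to be read. *)
Definition grab (P : bool -> autom unit) : autom unit :=
  push3 true ;; while (bind pop3 (fun o => if o is None then ret false else
    bind pop0 (fun o => if o is Some b then
      P b ;; (if b then push3 true ;; push3 true else ret tt) ;; ret true else ret false))).

Section Grab.
Variables (P : bool -> autom unit) (upd : seq bool * seq bool -> bool -> seq bool * seq bool).
Hypothesis HP : forall b x y z u,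
  sruns (P b) (x, y, z, u) 1 tt (x, (upd (y, z) b).1, (upd (y, z) b).2, u).

Lemma sruns_grab t x y z :
  sruns (grab P) (ser t ++ x, y, z, [::]) (12 * size (ser t)) tt
    (x, (foldl upd (y, z) (ser t)).1, (foldl upd (y, z) (ser t)).2, [::]).
Proof.
rewrite /grab; set B := bind pop3 _.
(* Continuation form: a run of the loop from behind [t] extends to one from before [t]. For [Cons]
   it is applied to the right and then to the left subtree, each matched by one of the two marks
   pushed on stack 3. *)
have H : forall t c x yz s'' U,
    sruns (while B) (x, (foldl upd yz (ser t)).1, (foldl upd yz (ser t)).2, c) U tt s'' ->
    sruns (while B) (ser t ++ x, yz.1, yz.2, true :: c) (8 * size (ser t) + U) tt s''.
  elim=> [|a IHa b IHb] {t x y z} c x [y z] s'' U /= H.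
    apply: sruns_le.
      apply: sruns_while_next H.
      apply: sruns_bind; first exact: sruns_pop3.
      apply: sruns_bind; first exact: sruns_pop0.
      apply: sruns_bind; first exact: HP.
      by apply: sruns_bind; exact: sruns_ret.
    by lia.
  move: H; rewrite foldl_cat => /IHb/IHa H.
  rewrite -catA; apply: sruns_le.
    apply: sruns_while_next H.
    apply: sruns_bind; first exact: sruns_pop3.
    apply: sruns_bind; first exact: sruns_pop0.
    apply: sruns_bind; first exact: HP.
    apply: sruns_bind; last exact: sruns_ret.
    by apply: sruns_bind; exact: sruns_push3.
  by rewrite size_cat; lia.
apply: sruns_le.
  apply: sruns_bind; first exact: sruns_push3.
  apply: (H t [::] x (y, z)).
  apply: sruns_while_end.
  apply: sruns_bind; first exact: sruns_pop3.
  exact: sruns_ret.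
have : 0 < size (ser t) by case: (t).
rewrite /=; lia.
Qed.
End Grab.

Lemma sruns_grab1 t x y z :
  sruns (grab push1) (ser t ++ x, y, z, [::]) (12 * size (ser t)) tt
    (x, rev (ser t) ++ y, z, [::]).
Proof.
have := @sruns_grab push1 (fun yz b => (b :: yz.1, yz.2)) _ t x y z.
have -> : foldl (fun yz b => (b :: yz.1, yz.2)) (y, z) (ser t) = (rev (ser t) ++ y, z).
  by elim: (ser t) y => [|b w IH] y //=; rewrite IH rev_cons cat_rcons.
by apply=> *; srun.
Qed.

Lemma sruns_grab2 t x y z :
  sruns (grab push2) (ser t ++ x, y, z, [::]) (12 * size (ser t)) tt
    (x, y, rev (ser t) ++ z, [::]).
Proof.
have := @sruns_grab push2 (fun yz b => (yz.1, b :: yz.2)) _ t x y z.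
have -> : foldl (fun yz b => (yz.1, b :: yz.2)) (y, z) (ser t) = (y, rev (ser t) ++ z).
  by elim: (ser t) z => [|b w IH] z //=; rewrite IH rev_cons cat_rcons.
by apply=> *; srun.
Qed.

Definition prun (A : autom unit) (x : seq bool) (T : nat) (x' : seq bool) : Prop :=
  sruns A (x, [::], [::], [::]) T tt (x', [::], [::], [::]).

Definition drop_top : autom unit := grab (fun=> ret tt).
(** Every pour reverses; the detour of the second copy through stack 1 restores its orientation. *)
Definition dup_top : autom unit := grab push1 ;; pour102 ;; pour21 ;; pour10.
Definition swap_top : autom unit := grab push1 ;; grab push2 ;; pour10 ;; pour20.

Lemma ser_gt0 t : 0 < size (ser t). Proof. by case: t. Qed.

Lemma prun_drop t x : prun drop_top (ser t ++ x) (12 * size (ser t)) x.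
Proof.
have := @sruns_grab (fun=> ret tt) (fun yz b => yz) _ t x [::] [::].
have -> : foldl (fun yz (b : bool) => yz) ([::], [::]) (ser t) = ([::], [::]) :> seq bool * seq bool.
  by elim: (ser t).
by apply=> *; srun.
Qed.

Lemma prun_dup t x : prun dup_top (ser t ++ x) (50 * size (ser t)) (ser t ++ ser t ++ x).
Proof.
rewrite /prun; apply: sruns_le.
  apply: sruns_bind; first exact: sruns_grab1.
  apply: sruns_bind; first exact: sruns_pour102.
  apply: sruns_bind; first exact: sruns_pour21.
  rewrite !cats0 revK.
  by have := sruns_pour10 (ser t ++ x) (rev (ser t)) [::] [::]; rewrite revK; apply.
rewrite !cats0 !revK !size_rev; have := ser_gt0 t; lia.
Qed.

Lemma prun_swap t t' x :
  prun swap_top (ser t ++ ser t' ++ x) (30 * (size (ser t) + size (ser t'))) (ser t' ++ ser t ++ x).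
Proof.
rewrite /prun; apply: sruns_le.
  apply: sruns_bind; first exact: sruns_grab1.
  apply: sruns_bind; first exact: sruns_grab2.
  apply: sruns_bind; first exact: sruns_pour10.
  rewrite !cats0 revK.
  by have := sruns_pour20 (ser t ++ x) [::] (rev (ser t')) [::]; rewrite revK; apply.
rewrite !cats0 !size_rev; have := ser_gt0 t; have := ser_gt0 t'; lia.
Qed.

Fixpoint pushs (w : seq bool) : autom unit :=
  if w is b :: w' then pushs w' ;; push0 b else ret tt.

Lemma sruns_pushs w x y z u : sruns (pushs w) (x, y, z, u) (size w).+1 tt (w ++ x, y, z, u).
Proof.
elim: w => [|b w IH]; first exact: sruns_ret.
by apply: sruns_le; [apply: sruns_bind IH _; exact: sruns_push0 | rewrite /=; lia].
Qed.

(** * Tree codes of data, and polynomial bounds in their size *)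

Class enc (A : Type) := encode : A -> tree.
#[export] Hint Mode enc ! : typeclass_instances.
Definition code {A} `{enc A} (a : A) : seq bool := ser (encode a).
Definition sz {A} `{enc A} (a : A) : nat := size (code a).

#[export] Instance enc_bool : enc bool := fun b => if b then Cons Nil Nil else Nil.
#[export] Instance enc_prod A B `{enc A} `{enc B} : enc (A * B) :=
  fun p => Cons (encode p.1) (encode p.2).
(** A nonempty list has the same code as the pair of its head and tail, and a number that of its bit
    list; machines are shared accordingly in [pt_cons] and [pt_nat_bits]. *)
#[export] Instance enc_seq A `{enc A} : enc (seq A) :=
  foldr (fun a t => Cons (encode a) t) Nil.
#[export] Instance enc_nat_bits : enc nat := fun n => encode (nat_bits n).

Lemma sz_gt0 {A} `{enc A} (a : A) : 0 < sz a. Proof. exact: ser_gt0. Qed.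

Lemma sz_pair {A B} `{enc A} `{enc B} (a : A) (b : B) : sz (a, b) = (sz a + sz b).+1.
Proof. by rewrite /sz /code /= size_cat. Qed.

Lemma sz_cons {A} `{enc A} (a : A) s : sz (a :: s) = (sz a + sz s).+1.
Proof. by rewrite /sz /code /= size_cat. Qed.

Lemma sz_bool (b : bool) : sz b <= 3. Proof. by case: b. Qed.

Lemma leq_exp2rW m n k : m <= n -> m ^ k <= n ^ k.
Proof. by case: k => [|k] mn; rewrite ?expn0 // leq_exp2r. Qed.

(** A single power replaces a polynomial: codes are nonempty, so the base is at least 2, and a sum
    of two numbers that are at least 2 is bounded by their product. *)
Definition pbd {A} `{enc A} (m : A -> nat) : Prop :=
  exists k, forall a, m a <= (sz a).+1 ^ k.

Section Pbd.
Context {A : Type} `{enc A}.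
Implicit Types m n : A -> nat.

Lemma pbd_le m n : pbd n -> (forall a, m a <= n a) -> pbd m.
Proof. by move=> [k Hk] mn; exists k => a; apply: leq_trans (Hk a). Qed.

Lemma pbd_sz : pbd (fun a : A => sz a).
Proof. by exists 1 => a; rewrite expn1. Qed.

Lemma pbd_const c : pbd (fun _ : A => c).
Proof.
exists c => a; apply: leq_trans (ltnW (ltn_expl c (isT : 1 < 2))) _.
by apply: leq_exp2rW; rewrite ?ltnS ?sz_gt0.
Qed.

Lemma sz_exp_ge2 (a : A) k : 0 < k -> 2 <= (sz a).+1 ^ k.
Proof.
move=> k0; apply: (@leq_trans (2 ^ k)); last by apply: leq_exp2rW; rewrite ltnS sz_gt0.
by rewrite -{1}(expn1 2) leq_exp2l.
Qed.

Lemma pbd_mul m n : pbd m -> pbd n -> pbd (fun a => m a * n a).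
Proof. by move=> [k Hk] [l Hl]; exists (k + l) => a; rewrite expnD leq_mul. Qed.

Lemma pbd_add m n : pbd m -> pbd n -> pbd (fun a => m a + n a).
Proof.
move=> [k Hk] [l Hl]; exists (k.+1 + l.+1) => a.
have H1 : m a <= (sz a).+1 ^ k.+1.
  by apply: leq_trans (Hk a) _; rewrite leq_exp2l ?ltnS ?sz_gt0.
have H2 : n a <= (sz a).+1 ^ l.+1.
  by apply: leq_trans (Hl a) _; rewrite leq_exp2l ?ltnS ?sz_gt0.
have := sz_exp_ge2 a (ltn0Sn k); have := sz_exp_ge2 a (ltn0Sn l).
rewrite expnD; move: (_ ^ k.+1) (_ ^ l.+1) H1 H2 => X Y; nia.
Qed.

Lemma pbd_exp m k : pbd m -> pbd (fun a => m a ^ k).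
Proof.
by move=> [l Hl]; exists (l * k) => a; rewrite expnM leq_exp2rW.
Qed.

Lemma pbd_comp {B} `{enc B} (f : A -> B) (m : B -> nat) :
  pbd m -> pbd (fun a => sz (f a)) -> pbd (fun a => m (f a)).
Proof.
move=> [k Hk] Hf; apply: pbd_le (fun a => Hk (f a)).
apply: pbd_exp; apply: (@pbd_le _ (fun a => sz (f a) + 1)).
  exact: pbd_add Hf (pbd_const 1).
by move=> a; rewrite addn1.
Qed.
End Pbd.

Ltac pbd_tac := cbv beta; first [assumption | lazymatch goal with
  | |- pbd (fun a => _ + _) => apply: pbd_add; pbd_tac
  | |- pbd (fun a => _ * _) => apply: pbd_mul; pbd_tac
  | |- pbd (fun a => _ ^ _) => apply: pbd_exp; pbd_tac
  | |- pbd (@sz _ _) => exact: pbd_sz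
  | |- _ => try exact: pbd_const
  end].

(* [pt f]: some machine replaces, in polynomial time, the code of [a] on top of
   stack 0 by the code of [f a], leaving the rest of the stack alone. *)
Definition pt {A B} `{enc A} `{enc B} (f : A -> B) : Prop :=
  exists (M : autom unit) (m : A -> nat), pbd m /\
  forall a x, prun M (code a ++ x) (m a) (code (f a) ++ x).

Section PtBasic.
Context {A B : Type} `{enc A} `{enc B}.

Lemma pt_ext (f g : A -> B) : (forall a, f a = g a) -> pt f -> pt g.
Proof. by move=> fg [M [m [Hm HM]]]; exists M, m; split=> // a x; rewrite -fg. Qed.

(** A stack operation adds at most one bit, so the running time bounds the growth of the output.
    Composition depends on this. *)
Lemma pt_sz (f : A -> B) : pt f -> pbd (fun a => sz (f a)).
Proof.
move=> [M [m [Hm HM]]]; apply: pbd_le (pbd_add pbd_sz Hm) _ => a.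
by have [_ + _] := HM a [::]; rewrite /ssize /tot /= !cats0 !addn0.
Qed.

Lemma pt_id : pt (fun a : A => a).
Proof. exists (ret tt), (fun=> 1); split; [exact: pbd_const | by move=> *; exact: sruns_ret]. Qed.

End PtBasic.

Section Pt.
Context {A B C : Type} `{enc A} `{enc B} `{enc C}.

Lemma pt_comp (g : B -> C) (f : A -> B) : pt g -> pt f -> pt (fun a => g (f a)).
Proof.
move=> [N [n [Hn HN]]] Hf; have szf := pt_sz Hf; move: Hf => [M [m [Hm HM]]].
exists (M ;; N), (fun a => m a + n (f a)); split.
  by apply: pbd_add => //; exact: pbd_comp.
by move=> a x; apply: sruns_bind; [exact: HM | exact: HN].
Qed.

Lemma pt_const (c : B) : pt (fun _ : A => c).
Proof.
exists (drop_top ;; pushs (code c)), (fun a => 12 * sz a + (sz c).+1); split.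
  by apply: pbd_add (pbd_const _); apply: pbd_mul (pbd_const _) pbd_sz.
by move=> a x; apply: sruns_bind; [exact: prun_drop | exact: sruns_pushs].
Qed.

Lemma pt_pair (f : A -> B) (g : A -> C) : pt f -> pt g -> pt (fun a => (f a, g a)).
Proof.
move=> Hf Hg; have szf := pt_sz Hf; have szg := pt_sz Hg.
move: Hf Hg => [M [m [Hm HM]]] [N [n [Hn HN]]].
exists (dup_top ;; M ;; swap_top ;; N ;; swap_top ;; push0 true),
  (fun a => 50 * sz a + (m a + (30 * (sz (f a) + sz a) +
            (n a + (30 * (sz (g a) + sz (f a)) + 1))))); split.
  by pbd_tac.
move=> a x; apply: sruns_bind; first exact: prun_dup.
apply: sruns_bind; first exact: HM.
apply: sruns_bind; first exact: prun_swap.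
apply: sruns_bind; first exact: HN.
apply: sruns_bind; first exact: prun_swap.
by rewrite /code /= -catA; exact: sruns_push0.
Qed.

Lemma pt_fst0 : pt (fun p : A * B => p.1).
Proof.
exists (pop0 ;; swap_top ;; drop_top), (fun p => 1 + (30 * sz p + 12 * sz p)); split.
  by pbd_tac.
move=> [a b] x; rewrite /code /= -catA.
apply: sruns_bind; first exact: sruns_pop0.
have szp := sz_pair a b; have := sz_gt0 a; have := sz_gt0 b => *.
apply: sruns_bind.
  by apply: sruns_le; [exact: prun_swap | rewrite szp /sz /code; lia].
by apply: sruns_le; [exact: prun_drop | rewrite szp /sz /code; lia].
Qed.

Lemma pt_snd0 : pt (fun p : A * B => p.2).
Proof.
exists (pop0 ;; drop_top), (fun p => 1 + (12 * sz p)); split.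
  by pbd_tac.
move=> [a b] x; rewrite /code /= -catA.
apply: sruns_bind; first exact: sruns_pop0.
have szp := sz_pair a b; have := sz_gt0 a; have := sz_gt0 b => *.
by apply: sruns_le; [exact: prun_drop | rewrite szp /sz /code; lia].
Qed.

Lemma pt_if (c : A -> bool) (f g : A -> B) :
  pt c -> pt f -> pt g -> pt (fun a => if c a then f a else g a).
Proof.
move=> [K [k [Hk HK]]] [M [m [Hm HM]]] [N [n [Hn HN]]].
(* The code of [true] is 1 0 0, so two more bits follow the one just read; the code of [false] is
   the single bit 0. *)
exists (dup_top ;; K ;; bind pop0 (fun o => if o is Some true then pop0 ;; pop0 ;; M else N)),
  (fun a => 50 * sz a + (k a + (3 + m a + n a))); split.
  by pbd_tac.
move=> a x; apply: sruns_bind; first exact: prun_dup.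
apply: sruns_bind; first exact: HK.
case: (c a).
  apply: sruns_le.
    apply: sruns_bind; first exact: sruns_pop0.
    apply: sruns_bind; first exact: sruns_pop0.
    apply: sruns_bind; first exact: sruns_pop0.
    exact: HM.
  by lia.
apply: sruns_le.
  apply: sruns_bind; first exact: sruns_pop0.
  exact: HN.
by lia.
Qed.

Lemma pt_case (l : A -> seq B) (f : A -> C) (g : A * (B * seq B) -> C) :
  pt l -> pt f -> pt g ->
  pt (fun a => if l a is x :: s then g (a, (x, s)) else f a).
Proof.
move=> Hl [M [m [Hm HM]]] [N [n [Hn HN]]].
have szl := pt_sz Hl; move: Hl => [K [k [Hk HK]]].
(* The tag that was popped is pushed back to complete the list again; the last [push0 true] joins
   [a] and the list into a pair. *)
exists (dup_top ;; K ;; bind pop0 (fun o => if o is Some true then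
   push0 true ;; swap_top ;; push0 true ;; N else M)),
  (fun a => 50 * sz a + (k a + (3 + 30 * (sz (l a) + sz a) + m a +
     (if l a is x :: s then n (a, (x, s)) else 0)))); split.
  have [e He] := Hn.
  pbd_tac.
  apply: (@pbd_le _ _ _ (fun a => ((sz a + sz (l a)).+2 ^ e))).
    apply: pbd_exp; apply: (@pbd_le _ _ _ (fun a => sz a + sz (l a) + 2)) => [|a].
      exact: pbd_add (pbd_add pbd_sz szl) (pbd_const 2).
    by lia.
  move=> a; case: (l a) => // x s; apply: leq_trans (He _) _.
  by rewrite sz_pair.
move=> a x; apply: sruns_bind; first exact: prun_dup.
apply: sruns_bind; first exact: HK.
case: (l a) => [|y s].
  apply: sruns_le.
    apply: sruns_bind; first exact: sruns_pop0.
    exact: HM.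
  by lia.
apply: sruns_le.
  apply: sruns_bind; first exact: sruns_pop0.
  apply: sruns_bind; first exact: sruns_push0.
  change (true :: behead (code (y :: s) ++ ser (encode a) ++ x)) with (code (y :: s) ++ code a ++ x).
  apply: sruns_bind; first exact: prun_swap.
  apply: sruns_bind; first exact: sruns_push0.
  have E : code (a, (y, s)) ++ x = true :: code a ++ code (y :: s) ++ x.
    by rewrite /code /= -catA.
  by have := HN (a, (y, s)) x; rewrite E; exact.
by rewrite -[size (ser (encode (y :: s)))]/(sz (y :: s)) -[size (ser (encode a))]/(sz a); lia.
Qed.
End Pt.

Lemma pt_cons {A B} `{enc A} `{enc B} (f : A -> B) (g : A -> seq B) :
  pt f -> pt g -> pt (fun a => f a :: g a).
Proof. by move=> Hf Hg; have [M [m [Hm HM]]] := pt_pair Hf Hg; exists M, m. Qed.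

Section PtLift.
Context {A B C D : Type} `{enc A} `{enc B} `{enc C} `{enc D}.

Lemma pt_fst (f : A -> B * C) : pt f -> pt (fun a => (f a).1).
Proof. exact: pt_comp pt_fst0. Qed.

Lemma pt_snd (f : A -> B * C) : pt f -> pt (fun a => (f a).2).
Proof. exact: pt_comp pt_snd0. Qed.

Lemma pt_app2 (h : B -> C -> D) (f : A -> B) (g : A -> C) :
  pt (fun p => h p.1 p.2) -> pt f -> pt g -> pt (fun a => h (f a) (g a)).
Proof. by move=> hh hf hg; exact: (pt_comp hh (pt_pair hf hg)). Qed.
End PtLift.

Section PtWhile.
Context {A S : Type} `{enc A} `{enc S}.
Variables (c : S -> bool) (h : S -> S) (s0 : A -> S) (N : A -> nat).
Hypotheses (ptc : pt c) (pth : pt h) (pts0 : pt s0).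
Hypotheses (pbdN : pbd N).
Hypothesis cN : forall a i, c (iter i h (s0 a)) = (i < N a) || ((N a < i) && c (iter i h (s0 a))).
Hypothesis bounded : exists2 m : A -> nat, pbd m &
  forall a i, i <= N a -> sz (iter i h (s0 a)) <= m a.

(** [cN] says that the test holds in every round before [N a] and fails in round [N a], and leaves
    later rounds open. The sizes of the intermediate states are bounded by hypothesis, since
    iterating a polynomial-time function can make them grow exponentially. *)
Lemma pt_while : pt (fun a => iter (N a) h (s0 a)).
Proof.
have [w pbdw Hw] := bounded.
move: ptc pth pts0 => [C [mc [[kc Hc] HC]]] [MH [mh [[kh Hh] HH]]] [I [mi [Hi HI]]].
pose B := dup_top ;; C ;; bind pop0 (fun o => if o is Some true then
  pop0 ;; pop0 ;; MH ;; ret true else ret false).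
pose W a := 50 * w a + (w a + 1) ^ kc + (w a + 1) ^ kh + 10.
have pW : pbd W.
  by rewrite /W; pbd_tac.
exists (I ;; while B), (fun a => mi a + W a * (N a + 1)); split.
  by pbd_tac.
move=> a x; apply: sruns_bind; first exact: HI.
have Hloop : forall j i, i + j = N a ->
    prun (while B) (code (iter i h (s0 a)) ++ x) (W a * (j + 1)) (code (iter (N a) h (s0 a)) ++ x).
  elim=> [|j IH] i ij.
    have ci : c (iter i h (s0 a)) = false by rewrite cN; lia.
    have szi := Hw a i (_ : i <= N a).
    apply: sruns_le.
      apply: sruns_while_end.
      apply: sruns_bind; first exact: prun_dup.
      apply: sruns_bind; first exact: HC.
      rewrite ci -ij addn0.
      apply: sruns_bind; first exact: sruns_pop0.
      exact: sruns_ret.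
    have {}szi := szi ltac:(lia).
    have : mc (iter i h (s0 a)) <= (w a + 1) ^ kc.
      by apply: leq_trans (Hc _) _; apply: leq_exp2rW; lia.
    rewrite -[size (ser (encode (iter i h (s0 a))))]/(sz (iter i h (s0 a))) /W; lia.
  have ci : c (iter i h (s0 a)) by rewrite cN; lia.
  have szi := Hw a i ltac:(lia).
  apply: sruns_le.
    apply: sruns_while_next.
      apply: sruns_bind; first exact: prun_dup.
      apply: sruns_bind; first exact: HC.
      rewrite ci.
      apply: sruns_bind; first exact: sruns_pop0.
      apply: sruns_bind; first exact: sruns_pop0.
      apply: sruns_bind; first exact: sruns_pop0.
      apply: sruns_bind; first exact: HH.
      exact: sruns_ret.
    apply: (IH i.+1); lia.
  have : mc (iter i h (s0 a)) <= (w a + 1) ^ kc.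
    by apply: leq_trans (Hc _) _; apply: leq_exp2rW; lia.
  have : mh (iter i h (s0 a)) <= (w a + 1) ^ kh.
    by apply: leq_trans (Hh _) _; apply: leq_exp2rW; lia.
  rewrite -[size (ser (encode (iter i h (s0 a))))]/(sz (iter i h (s0 a))).
  move: szi; rewrite /W; move: (sz _) (mc _) (mh _) (_ ^ kc) (_ ^ kh) => *; nia.
exact: (Hloop (N a) 0).
Qed.
End PtWhile.

Section PtFold.
Context {A B X : Type} `{enc A} `{enc B} `{enc X}.
Variables (step : A -> B -> X -> B) (b0 : A -> B) (l : A -> seq X).
Hypotheses (pts : pt (fun p : A * (B * X) => step p.1 p.2.1 p.2.2)).
Hypotheses (ptb : pt b0) (ptl : pt l).
Hypothesis bounded : exists2 m : A -> nat, pbd m &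
  forall a i, i <= size (l a) -> sz (foldl (step a) (b0 a) (take i (l a))) <= m a.

Lemma size_le_sz (s : seq X) : size s <= sz s.
Proof. by elim: s => //= x s IH; rewrite sz_cons; lia. Qed.

Lemma sz_drop i (s : seq X) : sz (drop i s) <= sz s.
Proof. by elim: s i => [|x s IH] [|i] //=; have := IH i; rewrite sz_cons; lia. Qed.

Local Notation S := (A * (B * seq X))%type.

(** Every later iteration is a fold: the number of rounds is the length of a list at hand, and only
    the size of the partial results remains to be bounded. *)
Lemma pt_foldl : pt (fun a => foldl (step a) (b0 a) (l a)).
Proof.
have [m pm Hm] := bounded.
pose h (s : S) : S := if s.2.2 is x :: t then (s.1, (step s.1 s.2.1 x, t)) else s.
pose c (s : S) : bool := if s.2.2 is x :: t then true else false.
pose s0 a : S := (a, (b0 a, l a)).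
have it a i : i <= size (l a) ->
    iter i h (s0 a) = (a, (foldl (step a) (b0 a) (take i (l a)), drop i (l a))).
  elim: i => [|i IH] il; first by rewrite take0 drop0.
  case E: (l a) => [|x0 t0]; first by rewrite E in il.
  rewrite iterS IH -?E; last by lia.
  rewrite /h /= (drop_nth x0 il) (take_nth x0 il) -cats1 foldl_cat //=.
have pf : pt (fun s : S => s.2.2) by apply: pt_snd; apply: pt_snd pt_id.
have P : pt (fun a => iter (size (l a)) h (s0 a)); last first.
  apply: (pt_ext _ (pt_fst (pt_snd P))) => a.
  by rewrite it //= take_size.
apply: (@pt_while _ _ _ _ c).
- by apply: (pt_case (g := fun=> true)) pf (pt_const _) (pt_const _).
- apply: (pt_case (g := fun p : S * (X * seq X) =>
     (p.1.1, (step p.1.1 p.1.2.1 p.2.1, p.2.2)))) pf pt_id _.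
  apply: pt_pair; first by apply: pt_fst; apply: pt_fst pt_id.
  apply: pt_pair; last by apply: pt_snd; apply: pt_snd pt_id.
  apply: (pt_comp (f := fun p : S * (X * seq X) => (p.1.1, (p.1.2.1, p.2.1))) pts).
  apply: pt_pair; first by apply: pt_fst; apply: pt_fst pt_id.
  apply: pt_pair; first by apply: pt_fst; apply: pt_snd; apply: pt_fst pt_id.
  by apply: pt_fst; apply: pt_snd pt_id.
- by apply: pt_pair pt_id (pt_pair ptb ptl).
- by apply: pbd_le (pt_sz ptl) _ => a; exact: size_le_sz.
- move=> a i; case: (ltngtP i (size (l a))) => [il|il|il] //=.
    rewrite it 1?ltnW // /c /=.
    by case E: (l a) il => [|x0 t0] // il; rewrite (drop_nth x0 il).
  by rewrite il it // drop_size.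
exists (fun a => sz a + (m a + sz (l a)) + 2).
  by have := pt_sz ptl => ?; pbd_tac.
move=> a i il; rewrite it // !sz_pair; have := Hm a i il; have := sz_drop i (l a); lia.
Qed.
End PtFold.

(** * From raw bit strings to tree codes and back; the final machine *)

Definition pour01 : autom unit := while (bind pop0 (fun o =>
  if o is Some b then push1 b ;; ret true else ret false)).

Definition load : autom unit := pour01 ;; push0 false ;; while (bind pop1 (fun o =>
  if o is Some b then pushs (code b) ;; push0 true ;; ret true else ret false)).

Lemma prun_load w : prun load w (20 * (size w).+1) (code w).
Proof.
have H1 : sruns pour01 (w, [::], [::], [::]) (5 * (size w).+1) tt ([::], rev w, [::], [::]).
  have := @sruns_drain _ (fun w x => (w, x, [::], [::])) (fun a b => b :: a) _ 4 _ _ w [::].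
  by rewrite catrev_foldl cats0; apply=> *; srun_le.
have -> : code w = foldl (fun a b => true :: code b ++ a) [:: false] (rev w).
  rewrite -[in LHS](revK w); elim/last_ind: (rev w) => [|v b IH] //.
  by rewrite rev_rcons -cats1 foldl_cat /= -IH.
apply: sruns_le.
  apply: sruns_bind; first exact: H1.
  apply: sruns_bind; first exact: sruns_push0.
  apply: (@sruns_drain _ (fun w x => (x, w, [::], [::]))
            (fun a b => true :: code b ++ a) _ 8) => [b v a|a]; last by srun_le.
  eapply sruns_le.
    apply: sruns_bind; first exact: sruns_pop1.
    apply: sruns_bind; first exact: sruns_pushs.
    apply: sruns_bind; first exact: sruns_push0.
    exact: sruns_ret.
  by case: b.
by rewrite size_rev; lia.
Qed.

Definition unload : autom unit := while (bind pop0 (fun o =>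
  if o is Some true then bind pop0 (fun o =>
     if o is Some true then pop0 ;; pop0 ;; push1 true ;; ret true
     else push1 false ;; ret true) else ret false)) ;; pour10.

Lemma prun_unload (w : seq bool) : prun unload (code w) (20 * (size w).+1) w.
Proof.
rewrite /unload; set B := bind pop0 _.
have H y : sruns (while B) (code w, y, [::], [::]) (10 * (size w).+1) tt
    ([::], rev w ++ y, [::], [::]).
  elim: w y => [|b w IH] y.
    by eapply sruns_le; [apply: sruns_while_end; rewrite /B /code; srun | by rewrite /=; lia].
  rewrite rev_cons cat_rcons.
  apply: sruns_le; first apply: sruns_while_next.
  - apply: (_ : sruns B (code (b :: w), y, [::], [::]) 7 true (code w, b :: y, [::], [::])).
    by rewrite /B /code; case: b => /=; srun_le.
  - exact: IH.
  - by rewrite /=; lia.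
apply: sruns_le; first apply: sruns_bind.
- exact: H.
- by have := sruns_pour10 [::] (rev w ++ [::]) [::] [::]; rewrite !cats0 revK; apply.
- by rewrite size_rev; lia.
Qed.

(** The run starts on the first input bit with nothing to its left. Stepping left and back creates
    the first separator; the blanks behind the input become three empty stacks. *)
Definition boot : autom unit :=
  go MoveL ;; go MoveR ;; scan MoveR ;; rep 3 (go MoveR) ;; rep 4 (skip MoveL).

Lemma runs_scanR_end x l :
  runs (scan MoveR) (stream l (msym x)) (2 * size x + 1) tt (stream (rev (msym x) ++ l) [::]).
Proof.
elim: x l => [|b x IH] l /=.
  by apply: runs_loop_end; apply: runs_act_eq.
have := IH (sym_of_bool b :: l).
rewrite rev_cons cat_rcons => H.
apply: runs_le; first apply: runs_loop_next H.
- apply: (@runs_act_eq _ _ _ (sym_of_bool b)); first by [].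
  + by case: (b).
  + exact: stream_moveR.
- by lia.
Qed.

Lemma runs_boot b w :
  exists2 t, srepr (b :: w, [::], [::], [::]) t &
  runs boot (stream [::] (msym (b :: w))) (10 * size w + 100) tt t.
Proof.
exists (stream [::] (Blank :: body [:: b :: w; [::]; [::]; [::]] ++ [::])).
  by exists 0.
apply: runs_le.
  apply: runs_bind; first exact: runs_goL.
  apply: runs_bind; first exact: (runs_goR [::] Blank (msym (b :: w))).
  apply: runs_bind; first exact: runs_scanR_end.
  apply: runs_bind.
    apply: runs_bind; first exact: (runs_goR _ Blank [::]).
    apply: runs_bind; first exact: (runs_goR _ Blank [::]).
    apply: runs_bind; first exact: (runs_goR _ Blank [::]).
    exact: runs_ret.
  exact: (runs_skipsL [:: b :: w; [::]; [::]; [::]] [::] [::]).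
by rewrite /tot /=; lia.
Qed.

Lemma read_out_msym w r : read_out (msym w ++ Blank :: r) = w.
Proof. by elim: w => [|[] w IH] //=; rewrite IH. Qed.

Lemma sz_bits (w : seq bool) : size w < sz w <= 4 * size w + 1.
Proof. by elim: w => //= b w; rewrite sz_cons; have := sz_bool b; have := sz_gt0 b; lia. Qed.

Theorem pt_tm (f : seq bool -> seq bool) : pt f ->
  exists (M : TM) (k : nat), forall w, 0 < size w ->
  halts_within M w ((size w).+1 ^ k) (f w).
Proof.
move=> ptf; have szf := pt_sz ptf; move: ptf => [F [m [pm HF]]].
pose (T := fun w : seq bool => 20 * sz w + (m w + 20 * sz (f w))).
pose (time := fun w : seq bool => 10 * sz w + 110 + 300 * (T w * (sz w + T w))).
have [k Hk] : pbd time.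
  by rewrite /time /T; pbd_tac.
(* [go MoveR] leaves the head on the first output bit, where [tm_output] starts reading. The factor
   3 passes from codes to words: [sz w + 1 <= 4 * size w + 2 <= (size w).+1 ^ 3] for nonempty
   [w]. *)
exists (tm_of (boot ;; (load ;; F ;; unload) ;; go MoveR)), (3 * k) => w w0.
have Hs : prun (load ;; F ;; unload) w (T w) (f w).
  apply: sruns_le.
    apply: sruns_bind; first exact: prun_load.
    apply: sruns_bind; first by have := HF w [::]; rewrite !cats0; apply.
    exact: prun_unload.
  by rewrite /T; have := sz_bits w; have := sz_bits (f w); lia.
case: w w0 Hs => [//|b w] _ [_ _ Hs].
have [t /Hs[t' [j ->] rt'] rt] := runs_boot b w.
have R : runs (boot ;; (load ;; F ;; unload) ;; go MoveR) (stream [::] (msym (b :: w)))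
    (time (b :: w)).-1 tt
    (stream [:: Blank] (body (seq_of_stacks (f (b :: w), [::], [::], [::])) ++ nseq j Blank)).
  apply: runs_le.
    apply: runs_bind; first exact: rt.
    apply: runs_bind; first exact: rt'.
    exact: runs_goR.
  have szw := sz_bits (b :: w); rewrite /= in szw.
  have : T (b :: w) * (ssize (b :: w, [::], [::], [::]) + T (b :: w)) <=
         T (b :: w) * (sz (b :: w) + T (b :: w)).
    by rewrite leq_mul2l leq_add2r /ssize /tot /=; lia.
  rewrite /time; lia.
have [n [nt [Hh Ho]]] := runs_tm R.
have E : forall l r, read_out ((stream l (body (seq_of_stacks (f (b :: w), [::], [::], [::]))
    ++ r)).1.2 :: (stream l (body (seq_of_stacks (f (b :: w), [::], [::], [::])) ++ r)).2)
    = f (b :: w).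
  by move=> l r; rewrite body_cons -[RHS](read_out_msym _ (body [:: [::]; [::]; [::]] ++ r)); case: (f _).
rewrite E in Ho.
exists n; split; last by [].
apply: leq_trans nt _; rewrite prednK; last by rewrite /time; lia.
apply: leq_trans (Hk _) _; rewrite expnM; apply: leq_exp2rW.
by have := sz_bits (b :: w); rewrite expnS expnS expn1 /=; nia.
Qed.

(** * Closure under boolean and list operations *)

Section PtBool.
Context {A : Type} `{enc A}.
Implicit Types f g : A -> bool.

Lemma pt_negb f : pt f -> pt (fun a => ~~ f a).
Proof. by move=> pf; apply: (pt_ext _ (pt_if pf (pt_const false) (pt_const true))) => a; case: (f a). Qed.
Lemma pt_andb f g : pt f -> pt g -> pt (fun a => f a && g a).
Proof. by move=> pf pg; apply: (pt_ext _ (pt_if pf pg (pt_const false))) => a; case: (f a). Qed.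
Lemma pt_orb f g : pt f -> pt g -> pt (fun a => f a || g a).
Proof. by move=> pf pg; apply: (pt_ext _ (pt_if pf (pt_const true) pg)) => a; case: (f a). Qed.
Lemma pt_addb f g : pt f -> pt g -> pt (fun a => f a (+) g a).
Proof. by move=> pf pg; apply: (pt_ext _ (pt_if pf (pt_negb pg) pg)) => a; case: (f a). Qed.
End PtBool.

Section PtHead.
Context {A X : Type} `{enc A} `{enc X}.

Lemma pt_head (d : A -> X) (l : A -> seq X) : pt d -> pt l -> pt (fun a => head (d a) (l a)).
Proof.
move=> pd pl; apply: (pt_ext _ (pt_case pl pd (pt_fst (pt_snd pt_id)))) => a.
by case: (l a).
Qed.

Lemma pt_behead (l : A -> seq X) : pt l -> pt (fun a => behead (l a)).
Proof.
move=> pl; apply: (pt_ext _ (pt_case pl (pt_const [::]) (pt_snd (pt_snd pt_id)))) => a.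
by case: (l a).
Qed.

Lemma pt_nilp (l : A -> seq X) : pt l -> pt (fun a => nilp (l a)).
Proof.
move=> pl; apply: (pt_ext _ (pt_case pl (pt_const true) (pt_const false))) => a.
by case: (l a).
Qed.
End PtHead.

Ltac pt_base := idtac; lazymatch goal with
  | |- pt (fun a => a) => exact: pt_id
  | |- pt (@fst _ _) => exact: pt_fst0
  | |- pt (@snd _ _) => exact: pt_snd0
  | |- pt (fun a => fst _) => apply: pt_fst
  | |- pt (fun a => snd _) => apply: pt_snd
  | |- pt (fun a => (_, _)) => apply: pt_pair
  | |- pt (fun a => _ && _) => apply: pt_andb
  | |- pt (fun a => _ || _) => apply: pt_orb
  | |- pt (fun a => _ (+) _) => apply: pt_addb
  | |- pt (fun a => ~~ _) => apply: pt_negb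
  | |- pt (fun a => _ :: _) => apply: pt_cons
  | |- pt (fun a => head _ _) => apply: pt_head
  | |- pt (fun a => behead _) => apply: pt_behead
  | |- pt (fun a => nilp _) => apply: pt_nilp
  | |- pt (fun a => if _ then _ else _) => apply: pt_if
  | |- _ => exact: pt_const
  end.
Ltac pt_tac0 := repeat (cbv beta; first [assumption | pt_base]).

Section Sizes.
Context {X : Type} `{enc X}.
Implicit Types s : seq X.

Lemma sz_nil : sz ([::] : seq X) = 1. Proof. by []. Qed.

Lemma sz_rev s : sz (rev s) = sz s.
Proof.
have E t : sz (catrev s t) + 1 = sz s + sz t; last first.
  by have := E [::]; rewrite -/(rev s) sz_nil; lia.
elim: s t => [|x s IH] t /=; first by rewrite sz_nil; lia.
by have := IH (x :: t); rewrite !sz_cons; lia.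
Qed.

Lemma sz_cat s t : sz (s ++ t) + 1 = sz s + sz t.
Proof.
elim: s => [|x s IH]; first by rewrite sz_nil addnC.
by rewrite cat_cons !sz_cons; lia.
Qed.

Lemma sz_take i s : sz (take i s) <= sz s.
Proof.
have h : 0 < sz (drop i s) by exact: sz_gt0.
by have := sz_cat (take i s) (drop i s); rewrite cat_take_drop; lia.
Qed.

Lemma sz_filter (p : pred X) s : sz (filter p s) <= sz s.
Proof. by elim: s => //= x s IH; case: (p x); rewrite !sz_cons; lia. Qed.

Lemma all_sz s : all (fun x => sz x <= sz s) s.
Proof.
elim: s => //= x s IH; rewrite sz_cons; apply/andP; split; first lia.
by apply: sub_all IH => y /=; lia.
Qed.

Lemma sz_bound s c : all (fun x => sz x <= c) s -> sz s <= size s * c.+1 + 1.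
Proof. by elim: s => //= x s IH /andP[xc /IH]; rewrite sz_cons; lia. Qed.
End Sizes.

Section PtRev.
Context {A X : Type} `{enc A} `{enc X}.

Lemma pt_rev (l : A -> seq X) : pt l -> pt (fun a => rev (l a)).
Proof.
move=> pl.
have P : pt (fun a => foldl (fun acc x => x :: acc) [::] (l a)); last first.
  by apply: (pt_ext _ P) => a; rewrite catrev_foldl cats0.
apply: (@pt_foldl _ _ _ _ _ _ (fun _ acc x => x :: acc)) => //; try by pt_tac0.
exists (fun a => sz (l a)); first exact: pt_sz.
by move=> a i _; rewrite catrev_foldl cats0 sz_rev sz_take.
Qed.

Lemma pt_cat (s t : A -> seq X) : pt s -> pt t -> pt (fun a => s a ++ t a).
Proof.
move=> ps pt'; have P : pt (fun a => foldl (fun acc x => x :: acc) (t a) (rev (s a))); last first.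
  by apply: (pt_ext _ P) => a; rewrite catrev_foldl revK.
apply: (@pt_foldl _ _ _ _ _ _ (fun _ acc x => x :: acc)) => //; try by pt_tac0.
  exact: pt_rev.
exists (fun a => sz (s a) + sz (t a)); first by have := pt_sz ps; have := pt_sz pt' => ? ?; pbd_tac.
move=> a i _; rewrite catrev_foldl.
have h1 : sz (rev (take i (rev (s a))) ++ t a) + 1 = sz (rev (take i (rev (s a)))) + sz (t a).
  exact: sz_cat.
have h2 : sz (take i (rev (s a))) <= sz (rev (s a)) by exact: sz_take.
by rewrite !sz_rev in h1 h2; lia.
Qed.

End PtRev.

Section PtList.
Context {A X Y : Type} `{enc A} `{enc X} `{enc Y}.

Lemma pt_bound (F : A -> X -> Y) (l : A -> seq X) :
  pt (fun p : A * X => F p.1 p.2) -> pt l ->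
  exists2 m : A -> nat, pbd m & forall a x, sz x <= sz (l a) -> sz (F a x) <= m a.
Proof.
move=> /pt_sz[k Hk] /pt_sz pl; exists (fun a => (sz a + sz (l a) + 2) ^ k).
  by pbd_tac.
move=> a x xl; have := Hk (a, x); rewrite /= sz_pair => Hax; apply: leq_trans Hax _.
by apply: leq_exp2rW; lia.
Qed.

Lemma pt_map (F : A -> X -> Y) (l : A -> seq X) :
  pt l -> pt (fun p : A * X => F p.1 p.2) -> pt (fun a => map (F a) (l a)).
Proof.
move=> pl pF.
have E a s : foldl (fun acc x => F a x :: acc) [::] s = rev (map (F a) s).
  by rewrite -[RHS]cats0 -catrev_foldl; elim: s [::] => //= x s IH acc.
have P : pt (fun a => foldl (fun acc x => F a x :: acc) [::] (l a)); last first.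
  have [M [m [pm HM]]] := pt_rev (pt_ext (fun a => E a _) P).
  by exists M, m; split=> // a x; have := HM a x; rewrite revK.
apply: (@pt_foldl _ _ _ _ _ _ (fun a acc x => F a x :: acc)) => //; try by pt_tac0.
  apply: pt_cons; last by pt_tac0.
  apply: (pt_comp (f := fun p : A * (seq Y * X) => (p.1, p.2.2)) pF); pt_tac0.
have [m pm Hm] := pt_bound pF pl.
exists (fun a => sz (l a) * (m a + 1) + 1); first by have := pt_sz pl => ?; pbd_tac.
move=> a i il; rewrite E sz_rev.
have A1 : all (fun y => sz y <= m a) (map (F a) (take i (l a))).
  rewrite all_map; apply: sub_all (_ : all (fun x => sz x <= sz (l a)) _).
    by move=> x /= /Hm.
  have : all (fun x => sz x <= sz (l a)) (l a) by exact: all_sz.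
  by rewrite -{2}(cat_take_drop i (l a)) all_cat => /andP[].
apply: leq_trans (sz_bound A1) _; rewrite size_map leq_add2r addn1 leq_mul2r.
have h : size (l a) <= sz (l a) by exact: size_le_sz.
by rewrite size_take; case: ifP; lia.
Qed.

End PtList.

Section PtList2.
Context {A X : Type} `{enc A} `{enc X}.

Lemma pt_filter (F : A -> X -> bool) (l : A -> seq X) :
  pt l -> pt (fun p : A * X => F p.1 p.2) -> pt (fun a => filter (F a) (l a)).
Proof.
move=> pl pF.
have E a s : foldl (fun acc x => if F a x then x :: acc else acc) [::] s = rev (filter (F a) s).
  rewrite -[RHS]cats0 -catrev_foldl; elim: s [::] => //= x s IH acc.
  by rewrite IH; case: (F a x).
have P : pt (fun a => foldl (fun acc x => if F a x then x :: acc else acc) [::] (l a)); last first.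
  have [M [m [pm HM]]] := pt_rev (pt_ext (fun a => E a _) P).
  by exists M, m; split=> // a x; have := HM a x; rewrite revK.
apply: (@pt_foldl _ _ _ _ _ _ (fun a acc x => if F a x then x :: acc else acc)) => //;
   try by pt_tac0.
  apply: pt_if; [|by pt_tac0|by pt_tac0].
  apply: (pt_comp (f := fun p : A * (seq X * X) => (p.1, p.2.2)) pF); pt_tac0.
exists (fun a => sz (l a)); first exact: pt_sz.
by move=> a i il; rewrite E sz_rev; apply: leq_trans (sz_filter _ _) (sz_take _ _).
Qed.

Lemma pt_has (F : A -> X -> bool) (l : A -> seq X) :
  pt l -> pt (fun p : A * X => F p.1 p.2) -> pt (fun a => has (F a) (l a)).
Proof.
move=> pl pF; apply: (pt_ext _ (pt_negb (pt_nilp (pt_filter pl pF)))) => a.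
by rewrite has_count -size_filter lt0n.
Qed.

Lemma pt_all (F : A -> X -> bool) (l : A -> seq X) :
  pt l -> pt (fun p : A * X => F p.1 p.2) -> pt (fun a => all (F a) (l a)).
Proof.
move=> pl pF; apply: (pt_ext _ (pt_negb (pt_has (F := fun a x => ~~ F a x) pl (pt_negb pF)))) => a.
by rewrite has_predC negbK.
Qed.

Lemma pt_flatten (l : A -> seq (seq X)) : pt l -> pt (fun a => flatten (l a)).
Proof.
move=> pl.
have E (s : seq (seq X)) t : foldl (fun acc x => acc ++ x) t s = t ++ flatten s.
  by elim: s t => [|x s IH] t /=; rewrite ?cats0 // IH catA.
have P : pt (fun a => foldl (fun acc x => acc ++ x) [::] (l a)); last first.
  by apply: (pt_ext _ P) => a; rewrite E.
apply: (@pt_foldl _ _ _ _ _ _ (fun a acc x => acc ++ x)) => //; try by pt_tac0.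
  by apply: pt_cat; pt_tac0.
exists (fun a => sz (l a)); first exact: pt_sz.
move=> a i il; rewrite E cat0s; apply: leq_trans (sz_take i _).
elim: (take _ _) => //= x s IH; have h : sz (x ++ flatten s) + 1 = sz x + sz (flatten s) by exact: sz_cat.
by rewrite sz_cons; lia.
Qed.
End PtList2.

(** * Binary arithmetic *)

Lemma bits_aux_fuel m n k : n <= m -> n <= k -> bits_aux m n = bits_aux k n.
Proof.
elim: m n k => [|m IH] [|n] [|k] //= nm nk.
by congr cons; apply: IH; lia.
Qed.

Lemma nat_bits_double (b : bool) n :
  nat_bits (b + n.*2) = if b || (0 < n) then b :: nat_bits n else [::].
Proof.
rewrite /nat_bits; case: (posnP n) => [->|n0]; first by case: b.
rewrite orbT; case E: (b + n.*2) => [|m]; first lia.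
have -> : bits_aux m.+1 m.+1 = odd m.+1 :: bits_aux m m.+1./2 by [].
rewrite -E oddD odd_double addbF half_bit_double; congr cons; first by case: (b).
apply: bits_aux_fuel => //; lia.
Qed.

Definition bval (s : seq bool) : nat := foldr (fun (b : bool) n => b + n.*2) 0 s.
Definition norm_bits (s : seq bool) : seq bool :=
  foldl (fun acc b => if b || ~~ nilp acc then b :: acc else [::]) [::] (rev s).

Lemma nat_bits_half n : 0 < n -> nat_bits n = odd n :: nat_bits n./2.
Proof.
by move=> n0; rewrite -{1}(odd_double_half n) nat_bits_double; case: ifP => // /negbT; lia.
Qed.

Lemma nat_bitsK : cancel nat_bits bval.
Proof.
elim/ltn_ind => n IH; case: (posnP n) => [->//|n0].
by rewrite nat_bits_half //= IH ?odd_double_half //; lia.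
Qed.

Lemma nilp_nat_bits n : nilp (nat_bits n) = (n == 0).
Proof. by case: (posnP n) => [->//|n0]; rewrite nat_bits_half //; lia. Qed.

Lemma bvalK s : nat_bits (bval s) = norm_bits s.
Proof.
elim: s => // b s IH; rewrite /= nat_bits_double /norm_bits rev_cons -cats1 foldl_cat /=.
by rewrite -/(norm_bits s) -IH nilp_nat_bits lt0n; case: ifP.
Qed.

Lemma bval_lt s : bval s < 2 ^ size s.
Proof. by elim: s => //= b s; rewrite expnS; case: b; lia. Qed.

Definition lg n := size (nat_bits n).

Lemma ltn_lg n : n < 2 ^ lg n.
Proof. by rewrite -{1}(nat_bitsK n); exact: bval_lt. Qed.

Lemma lg_le n k : n < 2 ^ k -> lg n <= k.
Proof.
elim: k n => [|k IH] n; first by rewrite expn0; case: n.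
move=> nk; case: (posnP n) => [->//|n0].
rewrite /lg nat_bits_half //= ltnS; apply: IH.
by rewrite expnS in nk; lia.
Qed.

Lemma lg_mono m n : m <= n -> lg m <= lg n.
Proof. by move=> mn; apply: lg_le; apply: leq_ltn_trans mn (ltn_lg n). Qed.

(** The bound has the form of the one for products, so that [pt_foldl_nat] covers both sums and
    products over lists. *)
Lemma lg_add m n : lg (m + n) <= lg m + lg n.
Proof. by apply: lg_le; rewrite expnD; have := ltn_lg m; have := ltn_lg n; nia. Qed.

Lemma lg_mul m n : lg (m * n) <= lg m + lg n.
Proof. by apply: lg_le; rewrite expnD; have := ltn_lg m; have := ltn_lg n; nia. Qed.

Lemma lg_leq n : lg n <= n.
Proof. by apply: lg_le; exact: ltn_expl. Qed.

Lemma sz_nat (n : nat) : lg n < sz n <= 4 * lg n + 1.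
Proof. exact: (sz_bits (nat_bits n)). Qed.

Section PtBits.
Context {A : Type} `{enc A}.

Lemma pt_nat_bits (f : A -> nat) : pt f -> pt (fun a => nat_bits (f a)).
Proof. by []. Qed.

(** A number is coded by its canonical bits, so computing [bval] amounts to stripping the zeros
    above the leading one. *)
Lemma pt_bval (f : A -> seq bool) : pt f -> pt (fun a => bval (f a)).
Proof.
move=> pf; have P : pt (fun a => norm_bits (f a)); last first.
  have [M [m [pm HM]]] := P; exists M, m; split=> // a x.
  have -> : code (bval (f a)) = code (norm_bits (f a)) by rewrite -bvalK.
  exact: HM.
apply: (@pt_foldl _ _ _ _ _ _ (fun _ acc b => if b || ~~ nilp acc then b :: acc else [::]) (fun=> [::])) => //;
  try by pt_tac0.
  exact: pt_rev.
exists (fun a => sz (f a)); first exact: pt_sz.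
move=> a i il; apply: leq_trans (_ : sz (take i (rev (f a))) <= _); last first.
  by rewrite -(sz_rev (f a)); exact: sz_take.
rewrite -[in X in _ <= X](sz_rev (take i (rev (f a)))).
elim/last_ind: (take _ _) => [//|s b IH]; rewrite -cats1 foldl_cat /= rev_cat /=.
case: ifP => _; rewrite !sz_cons ?sz_nil; lia.
Qed.
End PtBits.

Definition add_step (st : bool * (seq bool * (seq bool * seq bool))) (_ : bool) :=
  let c := st.1 in let x := head false st.2.1 in let y := head false st.2.2.1 in
  (x && y || c && (x || y),
   (behead st.2.1, (behead st.2.2.1, (x (+) y (+) c) :: st.2.2.2))).

(** Ripple-carry addition. The list [s ++ t] only serves as a clock, long enough to exhaust both
    operands; the last carry becomes the top bit. *)
Definition add_bits (s t : seq bool) : seq bool :=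
  let r := foldl add_step (false, (s, (t, [::]))) (s ++ t) in rev (r.1 :: r.2.2.2).

Lemma bval_cat s t : bval (s ++ t) = bval s + 2 ^ size s * bval t.
Proof. by elim: s => [|b s IH] /=; rewrite ?mul1n // IH expnS; lia. Qed.

Lemma bval_headE s : bval s = head false s + (bval (behead s)).*2.
Proof. by case: s. Qed.

Lemma add_stepsE w c s t out :
  let r := foldl add_step (c, (s, (t, out))) w in
  [/\ bval (rev out) + 2 ^ size out * (c + bval s + bval t) =
      bval (rev r.2.2.2) + 2 ^ size r.2.2.2 * (r.1 + bval r.2.1 + bval r.2.2.1),
      r.2.1 = drop (size w) s, r.2.2.1 = drop (size w) t & size r.2.2.2 = size out + size w].
Proof.
elim: w c s t out => [|b w IH] c s t out; first by rewrite /= !drop0 addn0.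
move=> r; have := IH (add_step (c, (s, (t, out))) b).1 (behead s) (behead t)
  ((head false s (+) head false t (+) c) :: out).
rewrite [foldl _ _ _](_ : _ = r) //= => -[<- -> -> ->]; split; last by lia.
- rewrite rev_cons -cats1 bval_cat size_rev expnS (bval_headE s) (bval_headE t) /=.
  by case: (head _ s); case: (head _ t); case: (c); rewrite /=; lia.
- by case: (s).
- by case: (t).
Qed.

Lemma bval_add_bits s t : bval (add_bits s t) = bval s + bval t.
Proof.
have [] := add_stepsE (s ++ t) false s t [::].
rewrite /add_bits; set r := foldl _ _ _.
rewrite /= mul1n => E ds dt _; rewrite add0n in E.
rewrite rev_cons -cats1 bval_cat size_rev /= addn0 E ds dt.
by rewrite !drop_oversize ?size_cat ?leq_addr ?leq_addl //= !addn0.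
Qed.

(** Bits are read from the lowest up, so a difference at a higher place overrides the verdict so
    far. *)
Definition leq_step (st : bool * (seq bool * seq bool)) (_ : bool) :=
  let x := head false st.2.1 in let y := head false st.2.2 in
  (if x (+) y then y else st.1, (behead st.2.1, behead st.2.2)).

Definition leq_bits (s t : seq bool) : bool := (foldl leq_step (true, (s, t)) (s ++ t)).1.

Lemma leq_stepsE w c s t :
  let r := foldl leq_step (c, (s, t)) w in
  [/\ (if bval s == bval t then c else bval s < bval t) =
      (if bval r.2.1 == bval r.2.2 then r.1 else bval r.2.1 < bval r.2.2),
      r.2.1 = drop (size w) s & r.2.2 = drop (size w) t].
Proof.
elim: w c s t => [|b w IH] c s t; first by rewrite /= !drop0.
move=> r; have := IH (leq_step (c, (s, t)) b).1 (behead s) (behead t).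
rewrite [foldl _ _ _](_ : _ = r) //= => -[<- -> ->]; split.
- rewrite (bval_headE s) (bval_headE t).
  case: (head _ s); case: (head _ t) => /=; do 2 (case: ifP => ?); lia.
- by case: (s).
- by case: (t).
Qed.

Lemma leq_bitsE s t : leq_bits s t = (bval s <= bval t).
Proof.
have [] := leq_stepsE (s ++ t) true s t.
rewrite /leq_bits; set r := foldl _ _ _ => E ds dt.
move: E; rewrite ds dt !drop_oversize ?size_cat ?leq_addr ?leq_addl //= => <-.
by case: ltngtP.
Qed.

Section PtNat.
Context {A : Type} `{enc A}.
Implicit Types f g : A -> nat.

Lemma pt_addn f g : pt f -> pt g -> pt (fun a => f a + g a).
Proof.
move=> pf pg; have P : pt (fun a => add_bits (nat_bits (f a)) (nat_bits (g a))); last first.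
  apply: (pt_ext _ (pt_bval P)) => a; by rewrite bval_add_bits !nat_bitsK.
have P : pt (fun a => foldl add_step (false, (nat_bits (f a), (nat_bits (g a), [::])))
                       (nat_bits (f a) ++ nat_bits (g a))); last first.
  by apply: pt_rev; apply: pt_cons; pt_tac0.
apply: (@pt_foldl _ _ _ _ _ _ (fun _ => add_step)).
- by rewrite /add_step /=; pt_tac0.
- by apply: pt_pair (pt_const _) (pt_pair (pt_nat_bits pf) (pt_pair (pt_nat_bits pg) (pt_const _))).
- by apply: pt_cat; exact: pt_nat_bits.
exists (fun a => 3 + (sz (f a) + (sz (g a) + (4 * (sz (f a) + sz (g a)) + 1))) + 3).
  by have := pt_sz pf; have := pt_sz pg => ? ?; pbd_tac.
move=> a i il.
have [_] := add_stepsE (take i (nat_bits (f a) ++ nat_bits (g a))) false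
  (nat_bits (f a)) (nat_bits (g a)) [::].
case: (foldl _ _ _) => [c [s [t out]]] /= -> -> so.
rewrite !sz_pair.
set j := size (take _ _).
have h0 : sz c <= 3 by exact: sz_bool.
have h1 : sz (drop j (nat_bits (f a))) <= sz (f a) by exact: sz_drop.
have h2 : sz (drop j (nat_bits (g a))) <= sz (g a) by exact: sz_drop.
have := sz_bits out; have := sz_nat (f a); have := sz_nat (g a).
rewrite so size_take_min; move: il; rewrite size_cat /lg; lia.
Qed.

Lemma pt_leq f g : pt f -> pt g -> pt (fun a => f a <= g a).
Proof.
move=> pf pg; have P : pt (fun a => leq_bits (nat_bits (f a)) (nat_bits (g a))); last first.
  by apply: (pt_ext _ P) => a; rewrite leq_bitsE !nat_bitsK.
apply: pt_fst; apply: (@pt_foldl _ _ _ _ _ _ (fun _ => leq_step)).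
- by rewrite /leq_step /=; pt_tac0.
- by apply: pt_pair (pt_const _) (pt_pair (pt_nat_bits pf) (pt_nat_bits pg)).
- by apply: pt_cat; exact: pt_nat_bits.
exists (fun a => 3 + (sz (f a) + sz (g a)) + 3).
  by have := pt_sz pf; have := pt_sz pg => ? ?; pbd_tac.
move=> a i il.
have [_] := leq_stepsE (take i (nat_bits (f a) ++ nat_bits (g a))) true
  (nat_bits (f a)) (nat_bits (g a)).
case: (foldl _ _ _) => [c [s t]] /= -> ->.
rewrite !sz_pair.
set j := size (take _ _).
have h0 : sz c <= 3 by exact: sz_bool.
have h1 : sz (drop j (nat_bits (f a))) <= sz (f a) by exact: sz_drop.
have h2 : sz (drop j (nat_bits (g a))) <= sz (g a) by exact: sz_drop.
lia.
Qed.

Lemma pt_eqn f g : pt f -> pt g -> pt (fun a => f a == g a).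
Proof.
move=> pf pg; apply: (pt_ext _ (pt_andb (pt_leq pf pg) (pt_leq pg pf))) => a.
by rewrite eqn_leq.
Qed.

Lemma pt_succn f : pt f -> pt (fun a => (f a).+1).
Proof. by move=> pf; apply: (pt_ext _ (pt_addn pf (pt_const 1))) => a; rewrite addn1. Qed.

Lemma pt_ltn f g : pt f -> pt g -> pt (fun a => f a < g a).
Proof. by move=> pf; apply: pt_leq; exact: pt_succn. Qed.

End PtNat.

Ltac pt_step := cbv beta; first [assumption | lazymatch goal with
  | |- pt (fun a => _ + _) => apply: pt_addn
  | |- pt (fun a => _ < _) => apply: pt_ltn
  | |- pt (fun a => _ <= _) => apply: pt_leq
  | |- pt (fun a => _ == _ :> nat) => apply: pt_eqn
  | |- pt (fun a => S _) => apply: pt_succn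
  | |- pt (fun a => nat_bits _) => apply: pt_nat_bits
  | |- pt (fun a => _ ++ _) => apply: pt_cat
  | |- pt (fun a => rev _) => apply: pt_rev
  | |- pt (fun a => flatten _) => apply: pt_flatten
  | |- pt (fun a => map _ _) => apply: pt_map
  | |- pt (fun a => filter _ _) => apply: pt_filter
  | |- pt (fun a => has _ _) => apply: pt_has
  | |- pt (fun a => all _ _) => apply: pt_all
  | |- _ => pt_base
  end].
Ltac pt_tac := repeat pt_step.

Section PtMul.
Context {A : Type} `{enc A}.

Lemma pt_muln (f g : A -> nat) : pt f -> pt g -> pt (fun a => f a * g a).
Proof.
move=> pf pg.
have E s n : foldl (fun acc (b : bool) => (if b then n else 0) + (acc + acc)) 0 (rev s) = bval s * n.
  by elim: s => [|b s IH] //; rewrite rev_cons -cats1 foldl_cat /= IH; case: b; lia.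
have P : pt (fun a => foldl (fun acc (b : bool) => (if b then g a else 0) + (acc + acc)) 0
   (rev (nat_bits (f a)))); last first.
  by apply: (pt_ext _ P) => a; rewrite E nat_bitsK.
apply: (@pt_foldl _ _ _ _ _ _ (fun a acc (b : bool) => (if b then g a else 0) + (acc + acc)) (fun=> 0)).
- by pt_tac; apply: (pt_comp pg); pt_tac.
- by pt_tac.
- by pt_tac.
exists (fun a => 4 * (sz (f a) + sz (g a)) + 1).
  by have := pt_sz pf; have := pt_sz pg => ? ?; pbd_tac.
move=> a i il; set s := take _ _.
have -> : s = rev (rev s) by rewrite revK.
rewrite E.
(* The bits read so far are the highest ones of [f a], so the partial results of the Horner scheme
   never exceed the final product. *)
have h1 : bval (rev s) <= f a.
  rewrite -[f a]nat_bitsK -[nat_bits _]revK -(cat_take_drop i (rev (nat_bits (f a)))) -/s.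
  rewrite rev_cat bval_cat; apply: leq_trans (leq_addl _ _).
  by rewrite leq_pmull // expn_gt0.
have := sz_nat (bval (rev s) * g a); have := lg_mul (bval (rev s)) (g a).
have := lg_mono h1; have := sz_nat (f a); have := sz_nat (g a); lia.
Qed.
End PtMul.

Section PtBig.
Context {A X : Type} `{enc A} `{enc X}.
Variables (F : A -> X -> nat) (l : A -> seq X).
Hypotheses (ptl : pt l) (ptF : pt (fun p : A * X => F p.1 p.2)).

Lemma pt_foldl_nat (op : nat -> nat -> nat) (c : nat) :
  (forall m n, lg (op m n) <= lg m + lg n) -> pt (fun p : nat * nat => op p.1 p.2) ->
  pt (fun a => foldl (fun acc x => op acc (F a x)) c (l a)).
Proof.
move=> lgop ptop.
have [m pm Hm] := pt_bound ptF ptl.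
apply: (@pt_foldl _ _ _ _ _ _ (fun a acc x => op acc (F a x)) (fun=> c)) => //.
- apply: (pt_app2 ptop); first by pt_tac.
  by apply: (pt_comp (f := fun p : A * (nat * X) => (p.1, p.2.2)) ptF); pt_tac.
- by pt_tac.
exists (fun a => 4 * (lg c + sz (l a) * m a) + 1).
  by have := pt_sz ptl => ?; pbd_tac.
move=> a i il.
have h1 : all (fun x => sz x <= sz (l a)) (take i (l a)).
  have : all (fun x => sz x <= sz (l a)) (l a) by exact: all_sz.
  by rewrite -{2}(cat_take_drop i (l a)) all_cat => /andP[].
have h2 : size (take i (l a)) <= sz (l a).
  have h : size (l a) <= sz (l a) by exact: size_le_sz.
  by rewrite size_take_min; lia.
have : lg (foldl (fun acc x => op acc (F a x)) c (take i (l a))) <=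
       lg c + size (take i (l a)) * m a.
  elim: (take i (l a)) c h1 {h2} => [|x s IH] c' /=; first by lia.
  move=> /andP[/Hm xl /IH]{}IH; apply: leq_trans (IH _) _.
  by have := lgop c' (F a x); have := sz_nat (F a x); lia.
set r := foldl _ _ _; have := sz_nat r.
have : size (take i (l a)) * m a <= sz (l a) * m a by rewrite leq_mul2r h2 orbT.
lia.
Qed.

Lemma pt_sum : pt (fun a => \sum_(x <- l a) F a x).
Proof.
have P : pt (fun a => foldl (fun acc x => acc + F a x) 0 (l a)).
  by apply: pt_foldl_nat; [exact: lg_add | pt_tac].
have E a s n : foldl (fun acc x => acc + F a x) n s = n + \sum_(x <- s) F a x.
  elim: s n => [|x s IH] n /=; first by rewrite big_nil addn0.
  by rewrite IH big_cons addnA.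
by apply: (pt_ext _ P) => a; rewrite E.
Qed.

Lemma pt_prod : pt (fun a => \prod_(x <- l a) F a x).
Proof.
have P : pt (fun a => foldl (fun acc x => acc * F a x) 1 (l a)).
  by apply: pt_foldl_nat; [exact: lg_mul | apply: pt_muln; pt_tac].
have E a s n : foldl (fun acc x => acc * F a x) n s = n * \prod_(x <- s) F a x.
  elim: s n => [|x s IH] n /=; first by rewrite big_nil muln1.
  by rewrite IH big_cons mulnA.
by apply: (pt_ext _ P) => a; rewrite E mul1n.
Qed.
End PtBig.

Section PtNth.
Context {A X : Type} `{enc A} `{enc X}.
Variables (l : A -> seq X).
Hypotheses (ptl : pt l).

Lemma pt_nth (d : X) (n : A -> nat) : pt n -> pt (fun a => nth d (l a) (n a)).
Proof.
move=> ptn.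
have E s k i (y : X) : k <= i ->
    foldl (fun st x => (st.1.+1, if st.1 == i then x else st.2)) (k, y) s
    = (k + size s, nth y s (i - k)).
  elim: s k y => [|x s IH] k y ki /=; first by rewrite addn0 nth_nil.
  case: (ltngtP k i) ki => [ki _|//|-> _].
    by have -> : i - k = (i - k.+1).+1; [lia | rewrite IH // addSnnS].
  rewrite subnn /= addnS -addSn.
  have K t j : i < j -> foldl (fun st x => (st.1.+1, if st.1 == i then x else st.2)) (j, x) t
      = (j + size t, x).
    elim: t j => [|y' t IHt] j ij /=; first by rewrite addn0.
    by rewrite (gtn_eqF ij) IHt ?addSnnS //; lia.
  exact: K.
have P : pt (fun a => foldl (fun st x => (st.1.+1, if st.1 == n a then x else st.2)) (0, d) (l a));
    last first.
  by apply: (pt_ext _ (pt_snd P)) => a; rewrite E // subn0.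
apply: (@pt_foldl _ _ _ _ _ _ (fun a (st : nat * X) x =>
  (st.1.+1, if st.1 == n a then x else st.2)) (fun=> (0, d))) => //.
- by pt_tac; apply: (pt_comp ptn); pt_tac.
- by pt_tac.
exists (fun a => 4 * sz (l a) + 1 + (sz d + sz (l a)) + 1).
  by have := pt_sz ptl => ?; pbd_tac.
move=> a i il; rewrite E // sz_pair subn0 add0n.
have h1 : size (take i (l a)) <= sz (l a).
  have h : size (l a) <= sz (l a) by exact: size_le_sz.
  by rewrite size_take_min; lia.
have h2 : sz (nth d (take i (l a)) (n a)) <= sz d + sz (l a).
  case: (ltnP (n a) (size (take i (l a)))) => [h|h]; last by rewrite nth_default ?leq_addr.
  have : all (fun x => sz x <= sz (l a)) (take i (l a)).
    have : all (fun x => sz x <= sz (l a)) (l a) by exact: all_sz.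
    by rewrite -{2}(cat_take_drop i (l a)) all_cat => /andP[].
  by move/all_nthP => /(_ d _ h); lia.
have := sz_nat (size (take i (l a))); have := lg_leq (size (take i (l a))); lia.
Qed.

(* [iota 0 n], cut at the length of [l] so that it stays of polynomial size. *)
Lemma pt_iota (n : A -> nat) : pt n -> pt (fun a => iota 0 (minn (n a) (size (l a)))).
Proof.
move=> ptn.
pose step n (st : nat * seq nat) (_ : X) := if st.1 < n then (st.1.+1, st.1 :: st.2) else st.
have E s m k : k <= m -> foldl (step m) (k, rev (iota 0 k)) s =
    (minn m (k + size s), rev (iota 0 (minn m (k + size s)))).
  elim: s k => [|x s IH] k km /=; first by rewrite addn0; have -> : minn m k = k by lia.
  rewrite {2}/step /=; case: ifP => h.
    have -> : k :: rev (iota 0 k) = rev (iota 0 k.+1) by rewrite -addn1 iotaD rev_cat.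
    by rewrite IH // addSnnS.
  rewrite IH //; have -> : minn m (k + (size s).+1) = minn m (k + size s) by lia.
  by [].
have P : pt (fun a => foldl (step (n a)) (0, [::]) (l a)); last first.
  by apply: (pt_ext _ (pt_rev (pt_snd P))) => a; rewrite (E _ _ 0) //= revK.
apply: (@pt_foldl _ _ _ _ _ _ (fun a => step (n a)) (fun=> (0, [::]))) => //.
- by rewrite /step; pt_tac; apply: (pt_comp ptn); pt_tac.
- by pt_tac.
exists (fun a => 4 * sz (l a) + 1 + (sz (l a) * (4 * sz (l a) + 2) + 1) + 1).
  by have := pt_sz ptl => ?; pbd_tac.
move=> a i il; rewrite (E _ _ 0) //= sz_pair sz_rev add0n.
set k := minn _ _.
have h1 : k <= sz (l a).
  have h : size (l a) <= sz (l a) by exact: size_le_sz.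
  by rewrite /k size_take_min; lia.
have h2 : forall j, j <= k -> sz j <= 4 * sz (l a) + 1.
  by move=> j jk; have := sz_nat j; have := lg_leq j; lia.
have : sz (iota 0 k) <= size (iota 0 k) * (4 * sz (l a) + 1).+1 + 1.
  by apply: sz_bound; apply/allP => j; rewrite mem_iota => jk; apply: h2; lia.
have := h2 k (leqnn k); rewrite size_iota.
have : k * (4 * sz (l a) + 1).+1 <= sz (l a) * (4 * sz (l a) + 2) by apply: leq_mul => //; lia.
lia.
Qed.
End PtNth.

(** * The algorithm *)

(* Parser modes: 0 expects a continuation flag, 1 a payload bit, 2 the second
   bit of the terminator, 3 a sign bit.  Only the first two tokens (the numbers of
   clients and facilities) are unsigned; all signs are ignored. *)
Definition parse_step (st : nat * (seq bool * seq (seq bool))) (b : bool) :=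
  let cur := st.2.1 in let toks := st.2.2 in
  if st.1 == 0 then (if b then 1 else 2, (cur, toks))
  else if st.1 == 1 then (0, (b :: cur, toks))
  else if st.1 == 2 then (if nilp toks then 0 else 3, ([::], cur :: toks))
  else (0, (cur, toks)).

Definition tokens (w : seq bool) : seq nat :=
  [seq bval (rev t) | t <- rev (foldl parse_step (0, ([::], [::])) w).2.2].

Lemma pt_tokens : pt tokens.
Proof.
have P : pt (fun w : seq bool => foldl parse_step (0, ([::], [::])) w); last first.
  apply: pt_map; first by pt_tac.
  by apply: pt_bval; pt_tac.
apply: (@pt_foldl _ _ _ _ _ _ (fun=> parse_step) (fun=> (0, ([::], [::]))) (fun w => w)).
- by rewrite /parse_step /=; pt_tac.
- exact: pt_const.
- exact: pt_id.
exists (fun w => 20 + (5 * sz w + 5)); first by pbd_tac.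
move=> w i il.
have H : forall s, let r := foldl parse_step (0, ([::], [::])) s in
    r.1 <= 3 /\ sz r.2.1 + sz r.2.2 <= 5 * size s + 2.
  elim/last_ind => [//|s b IH]; rewrite -cats1 foldl_cat size_cat /=.
  move: IH; case: (foldl _ _ _) => [m [cur toks]] /= [m3 IH].
  have hb : sz b <= 3 by exact: sz_bool.
  rewrite /parse_step /=; case: ifP => _; first by case: (b); split=> //=; lia.
  case: ifP => _ /=; first by rewrite sz_cons; lia.
  case: ifP => _ /=; last by lia.
  by rewrite sz_cons sz_nil; case: ifP => _; lia.
have := H (take i w); case: (foldl _ _ _) => [m [cur toks]] /= [m3 h].
rewrite !sz_pair; have h1 := sz_nat m; have h2 := lg_leq m.
have h3 := sz_bits w; move: h; rewrite size_take_min; lia.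
Qed.

(* (clients, facilities, scaled data, common denominator, sizes) *)
Notation env := (seq nat * (seq nat * (seq nat * (nat * (nat * nat)))))%type.

(** Entry [j] of the data has its numerator at position [2j + 2] and its denominator at [2j + 3].
    The numerator times all other denominators is the entry scaled by the common denominator. For an
    encoded instance [T] is longer than each of the three ranges, so nothing is cut off. *)
Definition env_of (T : seq nat) : env :=
  let nC := nth 0 T 0 in let nF := nth 0 T 1 in
  let cs := iota 0 (minn nC (size T)) in let fs := iota 0 (minn nF (size T)) in
  let js := iota 0 (minn (nF + nC * nF + nC) (size T)) in
  let den j := nth 0 T (j + j + 3) in
  (cs, (fs, ([seq nth 0 T (j + j + 2) * \prod_(i <- js) (if i == j then 1 else den i) | j <- js],
   (\prod_(i <- js) den i, (nC, nF))))).

Ltac pt_ext_step tac := cbv beta; first [assumption | lazymatch goal with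
  | |- pt (fun a => _ * _) => apply: pt_muln
  | |- pt (fun a => nth _ _ _) => apply: pt_nth
  | |- pt (fun a => iota 0 (minn _ (size _))) => apply: pt_iota
  | |- pt (fun a => \prod_(x <- _) _) => apply: pt_prod
  | |- pt (fun a => \sum_(x <- _) _) => apply: pt_sum
  | |- _ => first [tac | pt_step]
  end].

Lemma pt_env_of : pt env_of.
Proof. by rewrite /env_of /=; repeat pt_ext_step fail. Qed.

Section Algorithm.
Variable E : env.
Definition clients := E.1.
Definition facilities := E.2.1.
Definition data := E.2.2.1.
Definition scale := E.2.2.2.1.
Definition n_clients := E.2.2.2.2.1.
Definition n_fac := E.2.2.2.2.2.
Definition open_cost (f : nat) := nth 0 data f.
Definition dist (c f : nat) := nth 0 data (n_fac + c * n_fac + f).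
Definition weight (c : nat) := nth 0 data (n_fac + n_clients * n_fac + c).

Definition leq_frac (q q' : nat * nat) := q.1 * q'.2 <= q'.1 * q.2.

(* The radius of [f] is the least candidate.  The data are scaled by the common
   denominator, so [open_cost] needs one more factor [scale] to match [weight * dist]. *)
Definition candidate (f t : nat) : nat * nat :=
  (open_cost f * scale +
   \sum_(c <- clients) (if dist c f <= dist t f then weight c * dist c f else 0),
   \sum_(c <- clients) (if dist c f <= dist t f then weight c else 0)).

Definition candidates (f : nat) : seq (nat * nat) :=
  [seq q <- [seq candidate f t | t <- clients] | 0 < q.2].

(** Kept as a fraction, so that comparisons cross-multiply and nothing is divided. The default is
    taken only when no client has positive weight. *)
Definition radius (f : nat) : nat * nat :=
  head (0, 0) [seq q <- candidates f | all (leq_frac q) (candidates f)].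

(* An option [(q, g)] lets a client reach facility [g] at the extra price [q]. *)
Definition conflict (f : nat) (o : nat * nat) : bool :=
  has (fun c => (dist c f + dist c o.2 + o.1) * (radius f).2 <= 2 * (radius f).1) clients.

Definition free_fac (os : seq (nat * nat)) : seq nat :=
  [seq f <- facilities | ~~ has (conflict f) os].

Definition smallest (os : seq (nat * nat)) : seq nat :=
  [seq f <- free_fac os | all (fun g => leq_frac (radius f) (radius g)) (free_fac os)].

Definition grow (os : seq (nat * nat)) : seq (nat * nat) :=
  if nilp (smallest os) then os else (0, head 0 (smallest os)) :: os.

(** All rentals are on offer from the start. The facility list is the clock: a round with a free
    facility left makes at least one facility lose that status, so this many rounds suffice. *)
Definition options : seq (nat * nat) :=
  foldl (fun os _ => grow os) [seq (open_cost f, f) | f <- facilities] facilities.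

Definition assign (c : nat) : nat :=
  (head (0, 0) [seq o <- options |
     all (fun o' => o.1 + dist c o.2 <= o'.1 + dist c o'.2) options]).2.
End Algorithm.

Lemma pt_open_cost : pt (fun p : env * nat => open_cost p.1 p.2).
Proof. by rewrite /open_cost /data; repeat pt_ext_step fail. Qed.
Lemma pt_dist : pt (fun p : env * (nat * nat) => dist p.1 p.2.1 p.2.2).
Proof. by rewrite /dist /data /n_fac; repeat pt_ext_step fail. Qed.
Lemma pt_weight : pt (fun p : env * nat => weight p.1 p.2).
Proof. by rewrite /weight /data /n_fac /n_clients; repeat pt_ext_step fail. Qed.

Lemma pt_app3 {A B C D G} `{enc A} `{enc B} `{enc C} `{enc D} `{enc G}
  (h : B -> C -> D -> G) (f : A -> B) (g : A -> C) (k : A -> D) :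
  pt (fun p => h p.1 p.2.1 p.2.2) -> pt f -> pt g -> pt k -> pt (fun a => h (f a) (g a) (k a)).
Proof. by move=> ph pf pg pk; exact: (pt_comp ph (pt_pair pf (pt_pair pg pk))). Qed.

Ltac pt_alg := repeat pt_ext_step ltac:(idtac; lazymatch goal with
  | |- pt (fun a => open_cost _ _) => apply: (pt_app2 pt_open_cost)
  | |- pt (fun a => dist _ _ _) => apply: (pt_app3 pt_dist)
  | |- pt (fun a => weight _ _) => apply: (pt_app2 pt_weight)
  end).

Lemma pt_candidate : pt (fun p : env * (nat * nat) => candidate p.1 p.2.1 p.2.2).
Proof. by rewrite /candidate /clients /scale; pt_alg. Qed.

Lemma pt_candidates : pt (fun p : env * nat => candidates p.1 p.2).
Proof.
rewrite /candidates /clients; pt_alg.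
by apply: (pt_app3 pt_candidate); pt_alg.
Qed.

Lemma pt_radius : pt (fun p : env * nat => radius p.1 p.2).
Proof.
rewrite /radius /leq_frac; pt_alg.
- exact: pt_candidates.
- by apply: (pt_app2 pt_candidates); pt_alg.
Qed.

Lemma pt_conflict : pt (fun p : env * (nat * (nat * nat)) => conflict p.1 p.2.1 p.2.2).
Proof.
by rewrite /conflict /clients; pt_alg; apply: (pt_app2 pt_radius); pt_alg.
Qed.

Lemma pt_free_fac : pt (fun p : env * seq (nat * nat) => free_fac p.1 p.2).
Proof.
by rewrite /free_fac /facilities; pt_alg; apply: (pt_app3 pt_conflict); pt_alg.
Qed.

Lemma pt_smallest : pt (fun p : env * seq (nat * nat) => smallest p.1 p.2).
Proof.
rewrite /smallest /leq_frac; pt_alg; first exact: pt_free_fac.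
- by apply: (pt_app2 pt_free_fac); pt_alg.
all: by apply: (pt_app2 pt_radius); pt_alg.
Qed.

Lemma pt_grow : pt (fun p : env * seq (nat * nat) => grow p.1 p.2).
Proof. by rewrite /grow; pt_alg; exact: pt_smallest. Qed.

Lemma smallest_facilities E os f : f \in smallest E os -> f \in facilities E.
Proof. by rewrite !mem_filter => /and3P[_ _]. Qed.

Lemma pt_options : pt options.
Proof.
have pf : pt (fun E : env => facilities E) by rewrite /facilities; pt_alg.
have p0 : pt (fun E : env => [seq (open_cost E f, f) | f <- facilities E]).
  by apply: pt_map => //; pt_alg.
apply: (@pt_foldl _ _ _ _ _ _ (fun E os _ => grow E os)) => //.
  by apply: (pt_app2 pt_grow); pt_alg.
exists (fun E => sz [seq (open_cost E f, f) | f <- facilities E] +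
                 sz (facilities E) * (sz (facilities E) + 3)).
  by have := pt_sz pf; have := pt_sz p0 => ? ?; pbd_tac.
move=> E i il; set s := take i _.
have hs : size s <= sz (facilities E).
  have h : size (facilities E) <= sz (facilities E) by exact: size_le_sz.
  by rewrite /s size_take_min; lia.
have H : sz (foldl (fun os _ => grow E os) [seq (open_cost E f, f) | f <- facilities E] s) <=
       sz [seq (open_cost E f, f) | f <- facilities E] + size s * (sz (facilities E) + 3);
  last by nia.
elim/last_ind: s {hs} => [|s x IH]; first by rewrite addn0.
rewrite -cats1 foldl_cat size_cat /= {1}/grow; case: ifP => h; first by lia.
rewrite sz_cons sz_pair.
set os := foldl _ _ _ in IH h *.
have H : sz (head 0 (smallest E os)) <= sz (facilities E); last first.
  by have -> : sz 0 = 1 by []; lia.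
have : head 0 (smallest E os) \in smallest E os.
  by case: (smallest _ _) h => //= y ys _; rewrite mem_head.
move/smallest_facilities => hm.
have ha : all (fun x => sz x <= sz (facilities E)) (facilities E) by exact: all_sz.
exact: (allP ha).
Qed.

Lemma pt_assign : pt (fun p : env * nat => assign p.1 p.2).
Proof.
rewrite /assign; pt_alg; first by apply: (pt_comp pt_options); pt_alg.
by apply: (pt_comp pt_options); pt_alg.
Qed.

Definition solve (w : seq bool) : seq bool :=
  flatten [seq Defs.enc_nat (assign (env_of (tokens w)) c) | c <- clients (env_of (tokens w))].

Lemma pt_solve : pt solve.
Proof.
have pE : pt (fun w => env_of (tokens w)) := pt_comp pt_env_of pt_tokens.
have pc : pt (fun p : seq bool * nat => assign (env_of (tokens p.1)) p.2).
  by apply: (pt_app2 pt_assign); [apply: (pt_comp pE); pt_alg | pt_alg].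
rewrite /solve /Defs.enc_nat /clients; pt_alg.
Qed.

(** * Cost of a universal solution *)

Local Open Scope ring_scope.

Section Probability.
Variables (nC nF : nat) (o : {ffun 'I_nF -> rat}) (d : {ffun 'I_nC * 'I_nF -> rat}).
Variable (p : {ffun 'I_nC -> rat}).

Lemma act_prob_prod X :
  act_prob p X = \prod_c (if c \in X then p c else 1 - p c).
Proof.
rewrite /act_prob [RHS](bigID (mem X)) /=; congr (_ * _).
  by apply: eq_bigr => c ->.
by apply: eq_big => [c|c]; rewrite inE // => /negbTE ->.
Qed.

(** Expanding the product of the sums [F c + (1 - p c)] gives one term for each set [X]. It is the
    probability of [X] if [X] misses [S], and 0 otherwise because [F] vanishes on [S]. *)
Lemma sum_act_prob_miss (S : {set 'I_nC}) :
  \sum_(X : {set 'I_nC} | [disjoint S & X]) act_prob p X = \prod_(c in S) (1 - p c).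
Proof.
pose F c := if c \in S then 0 else p c.
transitivity (\prod_c (F c + (1 - p c))); last first.
  rewrite [RHS]big_mkcond /=; apply: eq_bigr => c _.
  by rewrite /F; case: ifP => _; rewrite ?add0r // addrCA subrr addr0.
rewrite bigA_distr big_mkcond /=; apply: eq_bigr => X _.
case: ifP => dSX.
  rewrite act_prob_prod; apply: eq_bigr => c _; case: ifP => // cX.
  by rewrite /F ifF //; apply: disjointFl dSX cX.
have /pred0Pn[c /andP[/= cS cX]] := negbT dSX.
by rewrite (bigD1 c) //= cX /F cS mul0r.
Qed.

Definition hit (S : {set 'I_nC}) : rat := 1 - \prod_(c in S) (1 - p c).

Lemma sum_act_prob : \sum_(X : {set 'I_nC}) act_prob p X = 1.
Proof.
have := sum_act_prob_miss set0; rewrite big_set0 => <-; apply: eq_bigl => X.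
by rewrite -setI_eq0 set0I eqxx.
Qed.

Lemma sum_act_prob_hit (S : {set 'I_nC}) :
  \sum_(X : {set 'I_nC} | ~~ [disjoint S & X]) act_prob p X = hit S.
Proof.
rewrite /hit -sum_act_prob_miss -{1}sum_act_prob.
by rewrite [X in _ = X - _](bigID (fun X : {set 'I_nC} => [disjoint S & X])) /= addrAC subrr add0r.
Qed.

Definition fiber (phi : {ffun 'I_nC -> 'I_nF}) (f : 'I_nF) : {set 'I_nC} := [set c | phi c == f].

(** Linearity of expectation: [f] is opened exactly when the active set meets its fiber, which
    replaces the sum over exponentially many scenarios by hitting probabilities. *)
Lemma universal_costE phi :
  universal_cost o d p phi =
  \sum_f o f * hit (fiber phi f) + \sum_c p c * d (c, phi c).
Proof.
rewrite /universal_cost /scenario_cost.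
under eq_bigr do rewrite mulrDr; rewrite big_split /=; congr (_ + _).
  under eq_bigr do rewrite big_mkcond mulr_sumr /=.
  rewrite exchange_big /=; apply: eq_bigr => f _.
  rewrite -sum_act_prob_hit mulr_sumr [RHS]big_mkcond /=; apply: eq_bigr => X _.
  have -> : (f \in phi @: X) = ~~ [disjoint fiber phi f & X].
    apply/imsetP/pred0Pn => [[c cX ->]|[c /andP[/=]]].
      by exists c; rewrite /= inE eqxx.
    by rewrite inE => /eqP <- cX; exists c.
  by case: ifP => _; rewrite ?mulr0 // mulrC.
under eq_bigr do rewrite big_mkcond mulr_sumr /=.
rewrite exchange_big /=; apply: eq_bigr => c _.
have -> : p c = hit [set c] by rewrite /hit big_set1 opprB addrCA subrr addr0.
rewrite -sum_act_prob_hit mulr_suml [RHS]big_mkcond /=; apply: eq_bigr => X _.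
rewrite disjoints1 negbK; by case: ifP => _; rewrite ?mulr0.
Qed.

Hypothesis p01 : forall c, 0 <= p c <= 1.

Lemma hit_le1 (S : {set 'I_nC}) : hit S <= 1.
Proof.
rewrite /hit; have : 0 <= \prod_(c in S) (1 - p c); last lra.
by apply: prodr_ge0 => c _; have := p01 c; lra.
Qed.

Lemma hit_union (S : {set 'I_nC}) : hit S <= \sum_(c in S) p c.
Proof.
rewrite /hit.
suff [_ _] : [/\ 0 <= \prod_(c in S) (1 - p c), \prod_(c in S) (1 - p c) <= 1 &
    1 - \sum_(c in S) p c <= \prod_(c in S) (1 - p c)] by lra.
apply: (big_rec2 (fun x y => [/\ 0 <= x, x <= 1 & 1 - y <= x])); first by split; lra.
by move=> c x y cS [x0 x1 xy]; have /andP[c0 c1] := p01 c; split; nra.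
Qed.

(** The induction shows [Q * (1 + P) <= 1]; hence [hit S >= P / (1 + P)], which is at least half of
    [min 1 P]. *)
Lemma hit_lower (S : {set 'I_nC}) : Num.min 1 (\sum_(c in S) p c) <= 2 * hit S.
Proof.
rewrite /hit; set P := \sum_(c in S) p c; set Q := \prod_(c in S) _.
have [P0 Q0 PQ] : [/\ 0 <= P, 0 <= Q & Q * (1 + P) <= 1].
  apply: (big_rec2 (fun x y => [/\ 0 <= x, 0 <= y & y * (1 + x) <= 1])); first by split; lra.
  move=> c x y cS [x0 y0 xy]; have /andP[c0 c1] := p01 c; split; [lra | nra | ].
  have h : (1 - p c) * (1 + (p c + x)) <= 1 + x by nra.
  have : y * ((1 - p c) * (1 + (p c + x))) <= y * (1 + x) by apply: ler_wpM2l.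
  by rewrite mulrA [y * _]mulrC; lra.
rewrite /Num.min; case: ltP => h; nra.
Qed.
End Probability.

(** * The greedy solution against an arbitrary mapping *)

Section Greedy.
Variables (nC nF : nat) (o : {ffun 'I_nF -> rat}) (d : {ffun 'I_nC * 'I_nF -> rat}).
Variable (p : {ffun 'I_nC -> rat}).
Hypotheses (o_ge0 : forall f, 0 <= o f) (p01 : forall c, 0 <= p c <= 1).
Hypotheses (d_ge0 : forall c f, 0 <= d (c, f)).
Hypothesis d_tri : forall c c' f g, d (c, g) <= d (c, f) + d (c', f) + d (c', g).

Variables (r : 'I_nF -> rat) (Z : {set 'I_nF}).
Definition payment c f : rat := Num.max (r f - d (c, f)) 0.
Hypothesis r_paid : forall f, \sum_c p c * payment c f = o f.
Hypothesis Z_far_rent : forall z, z \in Z -> forall g c, 2 * r z < d (c, z) + d (c, g) + o g.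
Hypothesis Z_far : forall z z', z \in Z -> z' \in Z -> z != z' -> r z <= r z' ->
  forall c, 2 * r z' < d (c, z) + d (c, z').
Hypothesis Z_cover : forall f,
  (exists g c, d (c, f) + d (c, g) + o g <= 2 * r f) \/
  (exists2 z, z \in Z & r z <= r f /\ exists c, d (c, f) + d (c, z) <= 2 * r f).

Variables (phi : {ffun 'I_nC -> 'I_nF}) (q : 'I_nC -> rat).
Hypothesis q_option : forall c, q c = o (phi c) \/ (q c = 0 /\ phi c \in Z).
Hypothesis q_rent : forall c g, q c + d (c, phi c) <= o g + d (c, g).
Hypothesis q_open : forall c z, z \in Z -> q c + d (c, phi c) <= d (c, z).

Definition share c : rat := q c + d (c, phi c) + \sum_(z in Z) payment c z.

Lemma q_ge0 c : 0 <= q c.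
Proof. by case: (q_option c) => [->|[-> _]]. Qed.

Lemma payment_ge0 c f : 0 <= payment c f.
Proof. by rewrite /payment le_max lexx orbT. Qed.

(** A client pays for at most one opened facility: two payments would give
    [d (c, z) + d (c, z') < r z + r z'], against [Z_far]. *)
Lemma payment_sum c :
  \sum_(z in Z) payment c z = 0 \/
  exists2 z, z \in Z & d (c, z) < r z /\ \sum_(z in Z) payment c z = r z - d (c, z).
Proof.
case: (boolP [exists z in Z, d (c, z) < r z]) => [/existsP[z /andP[zZ dz]]|].
  right; exists z => //; split=> //; rewrite (bigD1 z) //= big1 ?addr0.
    by rewrite /payment; apply/max_idPl; lra.
  move=> z' /andP[z'Z zz']; rewrite /payment; apply/max_idPr; rewrite subr_le0 leNgt.
  apply/negP => dz'; case: (leP (r z) (r z')) => rr.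
    by have := Z_far zZ z'Z; rewrite eq_sym zz' => /(_ isT rr c); lra.
  by have := Z_far z'Z zZ zz' (ltW rr) c; lra.
rewrite negb_exists => /forallP h; left; apply: big1 => z zZ.
by have := h z; rewrite zZ /= -leNgt => ?; apply/max_idPr; lra.
Qed.

(** If [c] pays for [z], the option [z] bounds its whole share by [r z], and [Z_far_rent] with
    [d (c, z) < r z] yields [r z < o f + d (c, f)]. The factor 3 is that of [share_open]. *)
Lemma share_rent c f : share c <= 3 * (o f + d (c, f)).
Proof.
rewrite /share; have := q_rent c f; have := o_ge0 f; have := d_ge0 c f.
case: (payment_sum c) => [->|[z zZ [dz ->]]]; first by lra.
by have := q_open c zZ; have := Z_far_rent zZ f c; lra.
Qed.

(** The option covering [f] costs [c] at most [d (c, f) + 2 * r f], the origin of the 3. If [c] pays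
    for [z], its share is at most [r z]: this is enough when [r z <= r f]; otherwise [z] is far from
    the covering option, which bounds [r z] by the cost of that option. *)
Lemma share_open c f : share c <= 3 * Num.max (r f) (d (c, f)).
Proof.
set m := Num.max _ _.
have rm : r f <= m by rewrite /m le_max lexx.
have dm : d (c, f) <= m by rewrite /m le_max lexx orbT.
have dcf := d_ge0 c f.
have [s [g [Ho Hd Hr]]] : exists s g,
   [/\ q c + d (c, phi c) <= s + d (c, g), s + d (c, g) <= d (c, f) + 2 * r f &
       forall z, z \in Z -> r f < r z -> 2 * r z < d (c, z) + d (c, g) + s].
  case: (Z_cover f) => [[g [c' h]]|[z zZ [rz [c' h]]]].
    exists (o g), g; split; first exact: q_rent.
      by have := d_tri c c' f g; lra.
    by move=> z zZ _; exact: Z_far_rent.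
  exists 0, z; split; first by rewrite add0r; exact: q_open.
    by have := d_tri c c' f z; lra.
  move=> z' z'Z rr; have zz' : z != z' by apply: contraTneq rr => <-; rewrite -leNgt.
  by have := Z_far zZ z'Z zz' (ltW (le_lt_trans rz rr)) c; lra.
rewrite /share; case: (payment_sum c) => [->|[z zZ [dz ->]]]; first by lra.
have := q_open c zZ; case: (leP (r z) (r f)) => rr; first by lra.
by have := Hr z zZ rr; lra.
Qed.

(** The payments for a facility in [Z] buy it outright. Any other facility is rented by all of its
    clients, and their expected rents are [o f] times the union bound on [hit]. *)
Lemma cost_le_share : universal_cost o d p phi <= \sum_c p c * share c.
Proof.
rewrite universal_costE.
have -> : \sum_c p c * share c =
    \sum_(z in Z) o z + \sum_c p c * q c + \sum_c p c * d (c, phi c).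
  rewrite /share; under eq_bigr do rewrite !mulrDr.
  rewrite !big_split /= addrC addrA; congr (_ + _ + _).
  under eq_bigr do rewrite mulr_sumr.
  by rewrite exchange_big /=; apply: eq_bigr => z _; exact: r_paid.
rewrite lerD2r [X in _ <= _ + X](partition_big phi predT) //=.
rewrite [X in _ <= X + _]big_mkcond -big_split /=.
apply: ler_sum => f _.
have q0 : 0 <= \sum_(i | phi i == f) p i * q i.
  by apply: sumr_ge0 => c _; apply: mulr_ge0; [have := p01 c; lra | exact: q_ge0].
case: ifP => fZ.
  by have := hit_le1 p01 (fiber phi f); have := o_ge0 f; nra.
rewrite add0r; apply: le_trans (_ : o f * \sum_(c in fiber phi f) p c <= _).
  by apply: ler_wpM2l => //; exact: hit_union.
rewrite mulr_sumr le_eqVlt; apply/orP; left; apply/eqP.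
apply: eq_big => [c|c]; first by rewrite inE.
rewrite inE => /eqP cf; case: (q_option c) => [->|[_]]; first by rewrite cf mulrC.
by rewrite cf fZ.
Qed.

(** Let [P] be the total probability of the clients that [psi] sends to [f]. If [P <= 1],
    [share_rent] charges [o f * P]; otherwise [share_open] with [max(r, d) = payment + d] and
    [r_paid] charges [o f] once. Either way the charge is [min(1, P) * o f], at most twice the
    expected opening cost. *)
Lemma share_le_cost psi : \sum_c p c * share c <= 6 * universal_cost o d p psi.
Proof.
rewrite universal_costE.
rewrite [X in X <= _](partition_big psi predT) //= [X in _ + X](partition_big psi predT) //= -big_split /= mulr_sumr.
apply: ler_sum => f _.
have -> : \sum_(i | psi i == f) p i * d (i, psi i) = \sum_(i | psi i == f) p i * d (i, f).
  by apply: eq_bigr => c /eqP ->.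
have D0 : 0 <= \sum_(i | psi i == f) p i * d (i, f).
  by apply: sumr_ge0 => c _; apply: mulr_ge0; [have := p01 c; lra | exact: d_ge0].
have h := hit_lower p01 (fiber psi f); rewrite (eq_bigl (fun c => psi c == f)) in h; last first.
  by move=> c; rewrite inE.
have of0 := o_ge0 f.
have [P1|P1] := leP (\sum_(c | psi c == f) p c) 1.
  apply: le_trans (_ : \sum_(c | psi c == f) p c * (3 * (o f + d (c, f))) <= _).
    apply: ler_sum => c _; apply: ler_wpM2l; [by have := p01 c; lra | exact: share_rent].
  rewrite (eq_bigr (fun c => 3 * o f * p c + 3 * (p c * d (c, f)))); last first.
    by move=> c _; ring.
  rewrite big_split /= -!mulr_sumr; rewrite (min_idPr P1) in h.
  by have : o f * \sum_(c | psi c == f) p c <= o f * (2 * hit p (fiber psi f));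
    [apply: ler_wpM2l | lra].
apply: le_trans (_ : \sum_(c | psi c == f) (3 * (p c * payment c f) + 3 * (p c * d (c, f))) <= _).
  apply: ler_sum => c _; apply: le_trans (_ : p c * (3 * Num.max (r f) (d (c, f))) <= _).
    apply: ler_wpM2l; [by have := p01 c; lra | exact: share_open].
  rewrite /payment; suff -> : Num.max (r f) (d (c, f)) = Num.max (r f - d (c, f)) 0 + d (c, f) by lra.
  by case: (leP (r f) (d (c, f))) => h0; case: (leP (r f - d (c, f)) 0) => h1; lra.
rewrite big_split /= -!mulr_sumr; rewrite (min_idPl (ltW P1)) in h.
have : \sum_(i | psi i == f) p i * payment i f <= o f.
  rewrite -r_paid big_mkcond /=; apply: ler_sum => c _; case: ifP => // _.
  by apply: mulr_ge0; [have := p01 c; lra | exact: payment_ge0].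
have : o f * 1 <= o f * (2 * hit p (fiber psi f)) by apply: ler_wpM2l.
lra.
Qed.

Theorem greedy_ratio psi : universal_cost o d p phi <= 6 * universal_cost o d p psi.
Proof. exact: le_trans cost_le_share (share_le_cost psi). Qed.
End Greedy.

(** * Correctness of the algorithm *)

Lemma exists_min (T : eqType) (key : T -> rat) (s : seq T) : s != [::] ->
  exists2 x, x \in s & forall y, y \in s -> key x <= key y.
Proof.
elim: s => [//|x [|y s] IH] _.
  by exists x; rewrite ?mem_head // => y; rewrite inE => /eqP ->.
have [//|z zs Hz] := IH.
case: (leP (key x) (key z)) => xz.
  exists x; first exact: mem_head.
  by move=> u; rewrite inE => /orP[/eqP -> //|/Hz]; exact: le_trans.
exists z; first by rewrite inE zs orbT.
by move=> u; rewrite inE => /orP[/eqP -> |/Hz //]; exact: ltW.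
Qed.

(** Common to the radius, the next facility to open and the assignment: a minimum exists, so the
    filtered list is nonempty and the default [x0] is not taken. *)
Lemma head_argmin (T : eqType) (le : rel T) (key : T -> rat) (x0 : T) (s : seq T) :
  {in s &, forall x y, le x y = (key x <= key y)} -> s != [::] ->
  let x := head x0 [seq x <- s | all (le x) s] in
  x \in s /\ forall y, y \in s -> key x <= key y.
Proof.
move=> leE s0; have [z zs Hz] := exists_min key s0.
have zf : z \in [seq x <- s | all (le x) s].
  by rewrite mem_filter zs andbT; apply/allP => y ys; rewrite leE // Hz.
move=> x; have : x \in [seq x <- s | all (le x) s].
  by rewrite /x; case: [seq _ <- _ | _] zf => // y t _; exact: mem_head.
rewrite mem_filter => /andP[/allP xle xs]; split=> // y ys.
by rewrite -leE // xle.
Qed.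

(** * The integer program read in rational terms *)

Section Semantics.
Variable E : env.
Hypothesis scale_gt0 : (0 < scale E)%N.
Hypothesis weight_gt0 : exists2 c, c \in clients E & (0 < weight E c)%N.

Notation D := ((scale E)%:R : rat).
Notation cs := (clients E).
Definition ro (f : nat) : rat := (open_cost E f)%:R / D.
Definition rd (c f : nat) : rat := (dist E c f)%:R / D.
Definition rp (c : nat) : rat := (weight E c)%:R / D.
(** In a candidate the numerator is scaled by [D ^ 2] and the denominator by [D]; the additional [D]
    restores the balance. *)
Definition frac (q : nat * nat) : rat := q.1%:R / (q.2%:R * D).
Definition rr (f : nat) : rat := frac (radius E f).

Let D0 : 0 < D. Proof. by rewrite ltr0n. Qed.
Let Dn0 : D != 0. Proof. by rewrite gt_eqF. Qed.

Lemma ro_ge0 f : 0 <= ro f. Proof. by rewrite divr_ge0. Qed.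
Lemma rd_ge0 c f : 0 <= rd c f. Proof. by rewrite divr_ge0. Qed.
Lemma rp_ge0 c : 0 <= rp c. Proof. by rewrite divr_ge0. Qed.

Lemma leq_fracE q q' : (0 < q.2)%N -> (0 < q'.2)%N -> leq_frac q q' = (frac q <= frac q').
Proof.
move=> q0 q'0; rewrite /leq_frac /frac.
have h : 0 < q.2%:R :> rat by rewrite ltr0n.
have h' : 0 < q'.2%:R :> rat by rewrite ltr0n.
rewrite ler_pdivrMr ?mulr_gt0 // mulrAC ler_pdivlMr ?mulr_gt0 //.
rewrite !mulrA ler_pM2r // -!natrM ler_nat.
by [].
Qed.

Definition near_weight f t : rat := \sum_(c <- cs) (if rd c f <= rd t f then rp c else 0).
Definition near_cost f t : rat := \sum_(c <- cs) (if rd c f <= rd t f then rp c * rd c f else 0).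

Lemma rd_le c t f : (dist E c f <= dist E t f)%N = (rd c f <= rd t f).
Proof. by rewrite /rd ler_pM2r ?invr_gt0 // ler_nat. Qed.

Lemma candidate_weight f t : (candidate E f t).2%:R = D * near_weight f t.
Proof.
rewrite /= natr_sum mulr_sumr; apply: eq_bigr => c _.
by rewrite rd_le; case: ifP => _; rewrite ?mulr0 // mulrC divfK.
Qed.

Lemma candidate_cost f t : (candidate E f t).1%:R = D * D * (ro f + near_cost f t).
Proof.
rewrite /= natrD mulrDr; congr (_ + _); first by rewrite natrM /ro; field.
rewrite natr_sum mulr_sumr; apply: eq_bigr => c _.
rewrite rd_le; case: ifP => _; rewrite ?mulr0 // natrM /rp /rd; by field.
Qed.

Lemma near_weight_gt0 f t : (0 < (candidate E f t).2)%N = (0 < near_weight f t).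
Proof. by rewrite -(ltr_nat rat) candidate_weight pmulr_rgt0. Qed.

Lemma candidate_frac f t : 0 < near_weight f t ->
  frac (candidate E f t) * near_weight f t = ro f + near_cost f t.
Proof.
move=> w0; rewrite /frac candidate_weight candidate_cost.
by field; rewrite Dn0 gt_eqF.
Qed.

Lemma mem_candidates f q : q \in candidates E f ->
  exists2 t, t \in cs & q = candidate E f t /\ 0 < near_weight f t.
Proof.
rewrite mem_filter => /andP[q0 /mapP[t tc qE]]; exists t => //; split=> //.
by rewrite -near_weight_gt0 -qE.
Qed.

Lemma candidates_neq0 f : candidates E f != [::].
Proof.
have [c cc w0] := weight_gt0.
have : candidate E f c \in candidates E f.
  rewrite mem_filter map_f // andbT near_weight_gt0 /near_weight.
  apply: lt_le_trans (_ : 0 < rp c) _; first by rewrite divr_gt0 // ltr0n.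
  rewrite (big_rem c) //= lexx lerDl; apply: sumr_ge0 => i _.
  by case: ifP => // _; exact: rp_ge0.
by case: (candidates E f).
Qed.

Lemma radiusP f : radius E f \in candidates E f /\
  forall q, q \in candidates E f -> rr f <= frac q.
Proof.
apply: head_argmin (candidates_neq0 f) => q q'.
by rewrite !mem_filter => /andP[q0 _] /andP[q'0 _]; exact: leq_fracE.
Qed.

Lemma radius_gt0 f : (0 < (radius E f).2)%N.
Proof. by have [] := radiusP f; rewrite mem_filter => /andP[]. Qed.

Lemma rr_eq f : exists2 t, t \in cs &
  0 < near_weight f t /\ rr f * near_weight f t = ro f + near_cost f t.
Proof.
have [/mem_candidates[t tc [qE w0]] _] := radiusP f; exists t => //; split=> //.
by rewrite /rr qE candidate_frac.
Qed.

Lemma rr_le f t : t \in cs -> 0 < near_weight f t ->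
  rr f * near_weight f t <= ro f + near_cost f t.
Proof.
move=> tc w0; rewrite -candidate_frac // ler_pM2r //.
by apply: (radiusP f).2; rewrite mem_filter near_weight_gt0 w0 map_f.
Qed.

Lemma near_cost_ge0 f t : 0 <= near_cost f t.
Proof.
by apply: sumr_ge0 => c _; case: ifP => // _; rewrite mulr_ge0 ?rp_ge0 ?rd_ge0.
Qed.

Lemma near_weight_ge0 f t : 0 <= near_weight f t.
Proof. by apply: sumr_ge0 => c _; case: ifP => // _; exact: rp_ge0. Qed.

Lemma near_split f t : rr f * near_weight f t - near_cost f t =
  \sum_(c <- cs) (if rd c f <= rd t f then rp c * (rr f - rd c f) else 0).
Proof.
rewrite /near_weight /near_cost mulr_sumr -sumrB; apply: eq_bigr => c _.
by case: ifP => _; [ring | rewrite mulr0 subr0].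
Qed.

(** For [<=], the clients nearer than [rr f] form a ball whose candidate is at least [rr f]. For
    [>=], the ball attaining the minimum already accounts for [ro f], and taking positive parts only
    increases the sum. *)
Lemma rr_paid f : \sum_(c <- cs) rp c * Num.max (rr f - rd c f) 0 = ro f.
Proof.
apply/eqP; rewrite eq_le; apply/andP; split.
  case: (eqVneq [seq c <- cs | rd c f < rr f] [::]) => [B0|Bn].
    rewrite big1_seq ?ro_ge0 // => c /= cc.
    have : c \notin [seq c <- cs | rd c f < rr f] by rewrite B0.
    rewrite mem_filter cc andbT -leNgt => h.
    by rewrite (_ : Num.max _ _ = 0) ?mulr0 //; apply/max_idPr; lra.
  (* the ball of radius [rr f] is the set of clients at least as near as its farthest one *)
  have [t tB tmax] := exists_min (fun c => - rd c f) Bn.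
  move: tB; rewrite mem_filter => /andP[tr tc].
  have -> : \sum_(c <- cs) rp c * Num.max (rr f - rd c f) 0 =
      rr f * near_weight f t - near_cost f t.
    rewrite near_split; apply: eq_big_seq => c cc.
    case: ifP => h; first by congr (_ * _); apply/max_idPl; lra.
    rewrite (_ : Num.max _ _ = 0) ?mulr0 //; apply/max_idPr.
    rewrite subr_le0 leNgt; apply/negP => cr.
    by have := tmax c; rewrite mem_filter cr cc => /(_ isT); lra.
  have [w0|w0] := ltP 0 (near_weight f t); first by have := rr_le tc w0; lra.
  have -> : near_weight f t = 0 by apply/eqP; rewrite eq_le w0 near_weight_ge0.
  by have := near_cost_ge0 f t; have := ro_ge0 f; lra.
have [t tc [w0 eq]] := rr_eq f.
have -> : ro f = rr f * near_weight f t - near_cost f t by lra.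
rewrite near_split; apply: ler_sum => c _; have pc := rp_ge0 c.
case: ifP => _; last by rewrite mulr_ge0 // le_max lexx orbT.
by apply: ler_wpM2l => //; rewrite le_max lexx.
Qed.

Lemma conflictE f q g : conflict E f (q, g) =
  has (fun c => rd c f + rd c g + q%:R / D <= 2 * rr f) cs.
Proof.
apply: eq_has => c /=; rewrite /rr /frac.
have h : 0 < (radius E f).2%:R :> rat by rewrite ltr0n radius_gt0.
rewrite mulrA ler_pdivlMr ?mulr_gt0 //.
rewrite (_ : (_ + _ + _) * _ = ((dist E c f + dist E c g + q) * (radius E f).2)%:R).
  by rewrite -[2]/(2%:R) -natrM ler_nat.
by rewrite natrM !natrD /rd; field.
Qed.

(** Some client is within [rr f] of [f]. Otherwise the sum of [rp c * (rr f - rd c f)] over the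
    attaining ball, which equals [ro f >= 0], has no positive term, so the ball has weight 0. Hence
    an opened facility is no longer free. *)
Lemma conflict_self f : conflict E f (0%N, f).
Proof.
rewrite conflictE; apply: contraT => /hasPn h.
have [t tc [w0 eq]] := rr_eq f; move: (w0); rewrite /near_weight big1_seq ?ltxx // => c /= cc.
have far : forall c, c \in cs -> rr f < rd c f.
  by move=> c' /h; rewrite mul0r -ltNge; lra.
have := near_split f t.
have -> : rr f * near_weight f t - near_cost f t = ro f by lra.
move=> e0; case: ifP => // ct.
have : \sum_(c <- cs) (if rd c f <= rd t f then rp c * (rd c f - rr f) else 0) <= 0.
  rewrite (_ : \sum_(c <- cs) _ = - ro f); first by have := ro_ge0 f; lra.
  by rewrite e0 -sumrN; apply: eq_bigr => i _; case: ifP => _; [ring | rewrite oppr0].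
rewrite (big_rem c) //= ct => hs.
have hs' : 0 <= \sum_(y <- rem c cs) (if rd y f <= rd t f then rp y * (rd y f - rr f) else 0).
  rewrite big_seq; apply: sumr_ge0 => i /mem_rem/far fi; case: ifP => // _.
  by apply: mulr_ge0; [exact: rp_ge0 | lra].
have := far c cc; have := rp_ge0 c => p0 fc.
apply/eqP; rewrite eq_le p0 andbT leNgt; apply/negP => pc.
by have : 0 < rp c * (rd c f - rr f); [apply: mulr_gt0; lra | lra].
Qed.

Notation rent := [seq (open_cost E f, f) | f <- facilities E].

Definition opened (zs : seq nat) : seq (nat * nat) := [seq (0%N, z) | z <- zs] ++ rent.

(** [inv_order] makes [inv_far] symmetric: a newcomer has the larger radius, and its being free
    separates it from the earlier ones at that radius. In [inv_cover], a facility blocked by [z]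
    during the scan was still free when [z] was chosen, so its radius is no smaller. *)
Record greedy_inv (zs : seq nat) : Prop := GreedyInv {
  inv_sub : {subset zs <= facilities E};
  inv_rent : forall z, z \in zs -> ~~ has (conflict E z) rent;
  inv_order : forall z f, z \in zs -> f \in free_fac E (opened zs) -> rr z <= rr f;
  inv_far : forall z z' c, z \in zs -> z' \in zs -> z != z' -> c \in cs ->
    2 * rr z < rd c z + rd c z';
  inv_cover : forall f, f \in facilities E -> has (conflict E f) (opened zs) ->
    has (conflict E f) rent \/ exists2 z, z \in zs & rr z <= rr f /\ conflict E f (0%N, z) }.

Lemma smallestP os : free_fac E os != [::] -> let z := head 0%N (smallest E os) in
  z \in free_fac E os /\ forall f, f \in free_fac E os -> rr z <= rr f.
Proof.
move=> fr; apply: (head_argmin (le := fun f g => leq_frac (radius E f) (radius E g))) => //.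
by move=> f g _ _; rewrite leq_fracE ?radius_gt0.
Qed.

Lemma grow_inv zs : greedy_inv zs -> free_fac E (opened zs) != [::] ->
  exists2 z, grow E (opened zs) = opened (z :: zs) & z \in free_fac E (opened zs) /\ greedy_inv (z :: zs).
Proof.
move=> [isub irent iorder ifar icover] fr.
have [zfree zmin] := smallestP fr; set z := head _ _ in zfree zmin.
have nsm : nilp (smallest E (opened zs)) = false.
  have [y yf ymin] := exists_min rr fr.
  have : y \in smallest E (opened zs).
    by rewrite mem_filter yf andbT; apply/allP => g /ymin; rewrite leq_fracE ?radius_gt0.
  by case: (smallest _ _).
exists z; first by rewrite /grow nsm.
split=> //.
have := zfree; rewrite mem_filter has_cat negb_or => /andP[/andP[zopen zrent] zfac].
have zc z' c : z' \in zs -> c \in cs -> 2 * rr z < rd c z + rd c z'.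
  move=> z's cc; have := hasPn zopen (0%N, z') (map_f _ z's).
  by rewrite conflictE => /hasPn/(_ c cc); rewrite -ltNge mul0r addr0.
split.
- by move=> x; rewrite inE => /orP[/eqP -> //|/isub].
- by move=> x; rewrite inE => /orP[/eqP -> //|/irent].
- move=> x f; rewrite inE => /orP[/eqP -> |xs] ff.
    by apply: zmin; move: ff; rewrite !mem_filter /= negb_or => /andP[/andP[_ ->] ->].
  by apply: iorder xs _; move: ff; rewrite !mem_filter /= negb_or => /andP[/andP[_ ->] ->].
- move=> x y c; rewrite !inE => /orP[/eqP -> |xs] /orP[/eqP -> |ys] xy cc.
  + by rewrite eqxx in xy.
  + exact: zc.
  + by have := zc x c xs cc; have := iorder x z xs zfree; lra.
  + exact: ifar.
move=> f ff; rewrite /=; case: (boolP (has (conflict E f) (opened zs))) => [/(icover _ ff)|nf].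
  move=> [h|[x xs h]] _; first by left.
  by right; exists x => //; rewrite inE xs orbT.
rewrite orbF => h; right; exists z; first exact: mem_head.
by split=> //; apply: zmin; rewrite mem_filter nf ff.
Qed.

Lemma free_shrink z os : z \in free_fac E os -> (size (free_fac E ((0%N, z) :: os)) < size (free_fac E os))%N.
Proof.
move=> zf; have -> : free_fac E ((0%N, z) :: os) =
    [seq f <- free_fac E os | ~~ conflict E f (0%N, z)].
  by rewrite /free -filter_predI; apply: eq_filter => f /=; rewrite negb_or.
rewrite size_filter -(count_predC (fun f => ~~ conflict E f (0%N, z)) (free_fac E os)).
rewrite -[X in (X < _)%N]addn0 ltn_add2l -has_count.
by apply/hasP; exists z => //=; rewrite negbK conflict_self.
Qed.

Lemma optionsP : exists2 zs, options E = opened zs & greedy_inv zs /\ free_fac E (opened zs) = [::].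
Proof.
have H (s : seq nat) : exists2 zs, foldl (fun os _ => grow E os) rent s = opened zs &
    greedy_inv zs /\ (size (free_fac E (opened zs)) <= size (facilities E) - size s)%N.
  elim/last_ind: s => [|s x [zs e [inv szf]]].
    exists [::] => //; split; last by rewrite subn0 size_filter count_size.
    by split=> // f ff; left.
  rewrite -cats1 foldl_cat /= e size_cat /=.
  case: (eqVneq (free_fac E (opened zs)) [::]) => [fr0|fr].
    exists zs; last by rewrite fr0.
    by rewrite /grow /smallest fr0.
  have [z -> [zf inv']] := grow_inv inv fr.
  exists (z :: zs) => //; split=> //.
  have := free_shrink zf; rewrite -[_ :: opened zs]/(opened (z :: zs)).
  by move: szf; lia.
have [zs e [inv h]] := H (facilities E).
exists zs => //; split=> //; apply/eqP; rewrite -size_eq0 -leqn0.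
by rewrite subnn in h.
Qed.

Lemma assignP c : facilities E != [::] -> exists2 o, o \in options E & o.2 = assign E c /\
  forall o', o' \in options E -> o.1%:R / D + rd c o.2 <= o'.1%:R / D + rd c o'.2.
Proof.
move=> fac0; have [zs e _] := optionsP.
have on0 : options E != [::].
  by rewrite e /opened; case: (zs) => //=; case: (facilities E) fac0.
have leE : {in options E &, forall o o' : nat * nat,
    (o.1 + dist E c o.2 <= o'.1 + dist E c o'.2)%N =
    (o.1%:R / D + rd c o.2 <= o'.1%:R / D + rd c o'.2)}.
  by move=> o o' _ _; rewrite /rd -!mulrDl ler_pM2r ?invr_gt0 // -!natrD ler_nat.
have [hin hmin] := head_argmin (key := fun o : nat * nat => o.1%:R / D + rd c o.2)
  (0%N, 0%N) leE on0.
by exists (head (0%N, 0%N) [seq o <- options E |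
     all (fun o' => (o.1 + dist E c o.2 <= o'.1 + dist E c o'.2)%N) (options E)]).
Qed.
End Semantics.

(** * Decoding an encoded instance *)

Lemma parse_enc_bits s cur toks :
  foldl parse_step (0%N, (cur, toks)) (flatten [seq [:: true; b] | b <- s] ++ [:: false; false]) =
  (if nilp toks then 0%N else 3%N, ([::], (rev s ++ cur) :: toks)).
Proof. by elim: s cur => [|b s IH] cur //=; rewrite IH rev_cons cat_rcons. Qed.

Lemma parse_enc_nat n toks :
  foldl parse_step (0%N, ([::], toks)) (Defs.enc_nat n) =
  (if nilp toks then 0%N else 3%N, ([::], rev (nat_bits n) :: toks)).
Proof. by rewrite /Defs.enc_nat parse_enc_bits cats0. Qed.

(** The explicit token [t] keeps the token list nonempty, so that the parser expects a sign after
    every number. *)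
Lemma parse_enc_rats qs t toks :
  foldl parse_step (3%N, ([::], t :: toks)) (flatten [seq enc_rat q | q <- qs]) =
  (3%N, ([::], rev (flatten [seq [:: rev (nat_bits `|numq q|); rev (nat_bits `|denq q|)] | q <- qs])
    ++ t :: toks)).
Proof.
elim: qs t toks => [|q qs IH] t toks //.
rewrite -[flatten (map enc_rat _)]/(enc_rat q ++ flatten [seq enc_rat q | q <- qs]) foldl_cat.
have -> : foldl parse_step (3%N, ([::], t :: toks)) (enc_rat q) =
    (3%N, ([::], [:: rev (nat_bits `|denq q|), rev (nat_bits `|numq q|), t & toks])).
  rewrite /enc_rat foldl_cat /enc_int.
  rewrite -[foldl _ _ (_ :: Defs.enc_nat `|numq q|)]/(foldl parse_step (0%N, ([::], t :: toks)) _).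
  rewrite parse_enc_nat.
  rewrite -[foldl _ _ (_ :: _)]/(foldl parse_step (0%N, ([::], _ :: t :: toks)) _).
  by rewrite parse_enc_nat.
by rewrite IH /= !rev_cons !cat_rcons.
Qed.

Lemma scale_env_of T : scale (env_of T) = (\prod_(i <- iota 0
  (minn (nth 0 T 1 + nth 0 T 0 * nth 0 T 1 + nth 0 T 0) (size T))) nth 0 T (i + i + 3))%N.
Proof. by []. Qed.

Lemma data_env_of T :
  let js := iota 0 (minn (nth 0 T 1 + nth 0 T 0 * nth 0 T 1 + nth 0 T 0) (size T)) in
  data (env_of T) =
  [seq (nth 0 T (j + j + 2) * \prod_(i <- js) (if i == j then 1 else nth 0 T (i + i + 3)))%N | j <- js].
Proof. by []. Qed.

Section Instance.
Variables (nC nF : nat) (o : {ffun 'I_nF -> rat}) (d : {ffun 'I_nC * 'I_nF -> rat}).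
Variable (p : {ffun 'I_nC -> rat}).

Definition entries : seq rat :=
  [seq o f | f <- enum 'I_nF] ++
  flatten [seq [seq d (c, f) | f <- enum 'I_nF] | c <- enum 'I_nC] ++
  [seq p c | c <- enum 'I_nC].

Definition n_entries : nat := (nF + nC * nF + nC)%N.

Lemma enc_instanceE : enc_instance o d p =
  Defs.enc_nat nC ++ Defs.enc_nat nF ++ flatten [seq enc_rat q | q <- entries].
Proof.
have rowsE : [seq enc_rat q | q <- flatten [seq [seq d (c, f) | f <- enum 'I_nF] | c <- enum 'I_nC]] =
    [seq enc_rat (d (c, f)) | c <- enum 'I_nC, f <- enum 'I_nF].
  rewrite map_flatten -map_comp; congr flatten; apply: eq_map => c /=.
  by rewrite -map_comp.
by rewrite /enc_instance /entries !map_cat !flatten_cat rowsE -!map_comp.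
Qed.

Lemma tokens_instance : tokens (enc_instance o d p) =
  [:: nC, nF & flatten [seq [:: `|numq q|%N; `|denq q|%N] | q <- entries]].
Proof.
rewrite /tokens enc_instanceE foldl_cat parse_enc_nat foldl_cat /= parse_enc_nat /=.
rewrite parse_enc_rats /= rev_cat revK /= !revK !nat_bitsK.
congr [:: _, _ & _]; elim: entries => //= q s ->.
by rewrite !revK !nat_bitsK.
Qed.

Lemma size_rows (T : Type) n (ss : seq (seq T)) :
  all (fun s => size s == n) ss -> size (flatten ss) = (size ss * n)%N.
Proof. by elim: ss => //= s ss IH /andP[/eqP sn /IH e]; rewrite size_cat sn e. Qed.

Lemma nth_rows (T : Type) (x0 : T) n (ss : seq (seq T)) i j :
  all (fun s => size s == n) ss -> (j < n)%N ->
  nth x0 (flatten ss) (i * n + j) = nth x0 (nth [::] ss i) j.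
Proof.
elim: ss i => [|s ss IH] i /=; first by rewrite !nth_nil.
move=> /andP[/eqP sn hs] jn; rewrite nth_cat sn; case: i => [|i] /=.
  by rewrite add0n jn.
by rewrite ifF ?mulSn; [rewrite -addnA addKn IH | lia].
Qed.

Let rows := [seq [seq d (c, f) | f <- enum 'I_nF] | c <- enum 'I_nC].
Let rowsP : all (fun s => size s == nF) rows.
Proof. by apply/allP => s /mapP[c _ ->]; rewrite size_map size_enum_ord. Qed.

Lemma size_entries : size entries = n_entries.
Proof.
rewrite /entries !size_cat (size_rows rowsP) size_map size_enum_ord size_map size_enum_ord.
by rewrite size_map size_enum_ord /n_entries addnA.
Qed.

Lemma nth_entries_o (f : 'I_nF) : nth 0 entries f = o f.
Proof.
rewrite /entries nth_cat size_map size_enum_ord ltn_ord.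
by rewrite (nth_map f) ?size_enum_ord // nth_ord_enum.
Qed.

Lemma nth_entries_d (c : 'I_nC) (f : 'I_nF) : nth 0 entries (nF + c * nF + f) = d (c, f).
Proof.
rewrite /entries nth_cat size_map size_enum_ord ifF; last by lia.
rewrite -addnA addKn nth_cat (size_rows rowsP) size_map size_enum_ord.
have cn := ltn_ord c; have fn := ltn_ord f.
rewrite ifT; last by nia.
rewrite (nth_rows _ _ rowsP) // (nth_map c) ?size_enum_ord // nth_ord_enum.
by rewrite (nth_map f) ?size_enum_ord // nth_ord_enum.
Qed.

Lemma nth_entries_p (c : 'I_nC) : nth 0 entries (nF + nC * nF + c) = p c.
Proof.
rewrite /entries nth_cat size_map size_enum_ord ifF; last by lia.
rewrite -addnA addKn nth_cat (size_rows rowsP) size_map size_enum_ord ifF; last by lia.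
by rewrite addKn (nth_map c) ?size_enum_ord // nth_ord_enum.
Qed.

Definition instance_env := env_of (tokens (enc_instance o d p)).
Local Notation E := instance_env.

Lemma size_pairs (s : seq rat) :
  size (flatten [seq [:: `|numq q|%N; `|denq q|%N] | q <- s]) = (size s + size s)%N.
Proof. by elim: s => //= q s ->; lia. Qed.

Lemma nth_pairs (s : seq rat) j : (j < size s)%N ->
  nth 0%N (flatten [seq [:: `|numq q|%N; `|denq q|%N] | q <- s]) (j + j) = `|numq (nth 0%R s j)|%N /\
  nth 0%N (flatten [seq [:: `|numq q|%N; `|denq q|%N] | q <- s]) (j + j).+1 = `|denq (nth 0%R s j)|%N.
Proof. by elim: s j => [|q s IH] [|j] //= js; rewrite addnS /=; apply: IH. Qed.

Let den j : nat := `|denq (nth 0%R entries j)|.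

Lemma env_clients : clients E = iota 0 nC.
Proof.
rewrite /clients /instance_env tokens_instance /env_of /= size_pairs size_entries /n_entries.
by congr (iota 0 _); lia.
Qed.

Lemma env_facilities : facilities E = iota 0 nF.
Proof.
rewrite /facilities /instance_env tokens_instance /env_of /= size_pairs size_entries /n_entries.
by congr (iota 0 _); lia.
Qed.

Lemma env_n_fac : n_fac E = nF.
Proof. by rewrite /n_fac /instance_env tokens_instance. Qed.

Lemma env_n_clients : n_clients E = nC.
Proof. by rewrite /n_clients /instance_env tokens_instance. Qed.

Lemma nth_tokens j : (j < n_entries)%N ->
  nth 0%N (tokens (enc_instance o d p)) (j + j + 2) = `|numq (nth 0%R entries j)|%N /\
  nth 0%N (tokens (enc_instance o d p)) (j + j + 3) = den j.
Proof.
by rewrite -size_entries => /nth_pairs[h1 h2]; rewrite tokens_instance addn2 addn3 /= h1 h2.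
Qed.

Lemma env_js : iota 0 (minn (nF + nC * nF + nC) (size (tokens (enc_instance o d p)))) = iota 0 n_entries.
Proof.
by rewrite tokens_instance /= size_pairs size_entries; congr (iota 0 _); rewrite /n_entries; lia.
Qed.

Lemma nth_tokens0 : nth 0%N (tokens (enc_instance o d p)) 0 = nC.
Proof. by rewrite tokens_instance. Qed.

Lemma nth_tokens1 : nth 0%N (tokens (enc_instance o d p)) 1 = nF.
Proof. by rewrite tokens_instance. Qed.

Lemma env_scale : scale E = (\prod_(i <- iota 0 n_entries) den i)%N.
Proof.
rewrite /instance_env scale_env_of nth_tokens0 nth_tokens1 env_js; apply: eq_big_seq => j; rewrite mem_iota add0n => /andP[_ jn].
by rewrite (nth_tokens jn).2.
Qed.

Lemma den_gt0 j : (0 < den j)%N.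
Proof. by rewrite absz_gt0 denq_neq0. Qed.

Lemma env_scale_gt0 : (0 < scale E)%N.
Proof. by rewrite env_scale; apply: prodn_gt0 => j; exact: den_gt0. Qed.

(** The parser drops signs; for a nonnegative entry the absolute value of the numerator is the
    numerator. *)
Lemma env_data j : (j < n_entries)%N -> 0 <= nth 0 entries j ->
  (nth 0%N (data E) j)%:R = (scale E)%:R * nth 0 entries j.
Proof.
move=> jn q0.
have -> : nth 0%N (data E) j = (`|numq (nth 0%R entries j)| *
    \prod_(i <- iota 0 n_entries) (if i == j then 1 else den i))%N.
  rewrite /instance_env data_env_of nth_tokens0 nth_tokens1 env_js (nth_map 0%N) ?size_iota // nth_iota // add0n (nth_tokens jn).1.
  congr (_ * _)%N; apply: eq_big_seq => i; rewrite mem_iota add0n => /andP[_ i_n].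
  by rewrite (nth_tokens i_n).2.
have jin : j \in iota 0 n_entries by rewrite mem_iota add0n.
rewrite env_scale (bigD1_seq j) ?iota_uniq //= [in RHS](bigD1_seq j) ?iota_uniq //=.
rewrite eqxx mul1n.
rewrite (eq_bigr den); last by move=> i /negbTE ->.
rewrite !natrM; set P := (\prod_(_ <- _ | _) _)%N.
have dq0 : (denq (nth 0 entries j))%:~R != 0 :> rat by rewrite intr_eq0 denq_neq0.
rewrite -[nth 0 entries j in RHS]divq_num_den /den !natr_absz.
rewrite ger0_norm ?numq_ge0 // gtr0_norm ?denq_gt0 //.
by field.
Qed.

Hypothesis valid : valid_instance o d p.

Lemma d_ge0 c f : 0 <= d (c, f).
Proof.
case: valid => _ [DD [D0 Dsym Dtri ->]] _.
by have := Dtri (inl c) (inr f) (inl c); rewrite D0 (Dsym (inr f)); lra.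
Qed.

(** The triangle inequality in terms of client-facility distances alone, along the path from [c]
    through [f] and [c'] to [g]. *)
Lemma d_tri c c' f g : d (c, g) <= d (c, f) + d (c', f) + d (c', g).
Proof.
case: valid => _ [DD [D0 Dsym Dtri dE]] _; rewrite !dE.
have := Dtri (inl c) (inr f) (inr g); have := Dtri (inr f) (inl c') (inr g).
by rewrite (Dsym (inr f) (inl c')); lra.
Qed.

Lemma env_ro (f : 'I_nF) : ro E f = o f.
Proof.
case: valid => o0 _ _; have fn := ltn_ord f.
rewrite /ro /open_cost env_data ?nth_entries_o //; last by rewrite /n_entries; lia.
by rewrite mulrAC divff ?mul1r // pnatr_eq0 -lt0n env_scale_gt0.
Qed.

Lemma env_rd (c : 'I_nC) (f : 'I_nF) : rd E c f = d (c, f).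
Proof.
have fn := ltn_ord f; have cn := ltn_ord c.
rewrite /rd /dist env_n_fac env_data ?nth_entries_d ?d_ge0 //; last by rewrite /n_entries; nia.
by rewrite mulrAC divff ?mul1r // pnatr_eq0 -lt0n env_scale_gt0.
Qed.

Lemma env_weight (c : 'I_nC) : (weight E c)%:R = (scale E)%:R * p c.
Proof.
case: valid => _ _ p01; have cn := ltn_ord c; have /andP[p0 _] := p01 c.
rewrite /weight env_n_fac env_n_clients env_data ?nth_entries_p //.
by rewrite /n_entries; lia.
Qed.

Lemma env_rp (c : 'I_nC) : rp E c = p c.
Proof. by rewrite /rp env_weight mulrAC divff ?mul1r // pnatr_eq0 -lt0n env_scale_gt0. Qed.
End Instance.

Lemma assign_facility (E : env) c : facilities E != [::] -> assign E c \in facilities E.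
Proof.
move=> fac0.
have H (s : seq nat) : let os := foldl (fun os _ => grow E os)
    [seq (open_cost E f, f) | f <- facilities E] s in
    os != [::] /\ all (fun o => o.2 \in facilities E) os.
  elim/last_ind: s => [|s x [os0 osf]].
    split; first by case: (facilities E) fac0.
    by rewrite all_map; apply/allP.
  rewrite -cats1 foldl_cat /=; move: (foldl _ _ _) os0 osf => os os0 osf.
  rewrite /grow; case: ifP => // h; split=> //=; rewrite osf andbT.
  apply: (@smallest_facilities _ os).
  by case: (smallest E os) h => //= y t _; exact: mem_head.
have [on0 /allP oall] := H (facilities E).
have [hin _] := head_argmin (le := fun o o' : nat * nat => (o.1 + dist E c o.2 <= o'.1 + dist E c o'.2)%N)
  (key := fun o : nat * nat => (o.1 + dist E c o.2)%:R) (0%N, 0%N)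
  (fun o o' _ _ => esym (ler_nat rat _ _)) on0.
exact: oall hin.
Qed.

(** * The mapping that is output, and its ratio *)

Section Output.
Variables (nC nF : nat) (o : {ffun 'I_nF -> rat}) (d : {ffun 'I_nC * 'I_nF -> rat}).
Variable (p : {ffun 'I_nC -> rat}).
Hypotheses (nF0 : (0 < nF)%N) (valid : valid_instance o d p).
Local Notation E := (instance_env o d p).

Definition solution : {ffun 'I_nC -> 'I_nF} :=
  [ffun c : 'I_nC => insubd (Ordinal nF0) (assign E c)].

Lemma facilities_neq0 : facilities E != [::].
Proof. by rewrite env_facilities; case: nF nF0. Qed.

Lemma solutionE c : solution c = assign E c :> nat.
Proof.
rewrite ffunE val_insubd.
have := assign_facility c facilities_neq0.
by rewrite env_facilities mem_iota add0n => /andP[_ ->].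
Qed.

Lemma solve_instance : solve (enc_instance o d p) = enc_mapping solution.
Proof.
rewrite /solve -/E env_clients /enc_mapping -val_enum_ord -map_comp.
by congr flatten; apply: eq_map => c; rewrite solutionE.
Qed.

Lemma sum_clients (F : nat -> rat) : \sum_(c <- clients E) F c = \sum_(c < nC) F c.
Proof. by rewrite env_clients -(big_mkord xpredT F) /index_iota subn0. Qed.

Lemma mem_clients (c : 'I_nC) : val c \in clients E.
Proof. by rewrite env_clients mem_iota add0n ltn_ord. Qed.

Lemma mem_facilities (f : 'I_nF) : val f \in facilities E.
Proof. by rewrite env_facilities mem_iota add0n ltn_ord. Qed.

Lemma clients_ord c : c \in clients E -> exists c' : 'I_nC, c = val c'.
Proof. by rewrite env_clients mem_iota add0n => /andP[_ h]; exists (Ordinal h). Qed.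

Lemma facilities_ord f : f \in facilities E -> exists f' : 'I_nF, f = val f'.
Proof. by rewrite env_facilities mem_iota add0n => /andP[_ h]; exists (Ordinal h). Qed.

(** A positive probability gives a positive weight, on which the existence of the radii rests. The
    price [q c] is that of the option assigned to [c]: a rent, or 0 for an opened facility. *)
Lemma solution_ratio_pos : (exists c, 0 < p c) -> forall psi,
  universal_cost o d p solution <= 6 * universal_cost o d p psi.
Proof.
move=> [c0 pc0] psi.
have w0 : exists2 c, c \in clients E & (0 < weight E c)%N.
  exists (val c0); first exact: mem_clients.
  by rewrite -(ltr_nat rat) env_weight // mulr_gt0 // ltr0n env_scale_gt0.
have s0 := env_scale_gt0 o d p.
have [o0 _ p01] := valid.
have [zs eopt [inv fr0]] := optionsP s0 w0.
have D0 : (0 : rat) < (scale E)%:R by rewrite ltr0n.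
have oE (f : 'I_nF) : (open_cost E f)%:R / (scale E)%:R = o f by exact: env_ro valid f.
have rentP (f : 'I_nF) : has (conflict E f) [seq (open_cost E g, g) | g <- facilities E] ->
    exists g c, d (c, f) + d (c, g) + o g <= 2 * rr E f.
  rewrite has_map => /hasP[g /facilities_ord[g' ->]] /=.
  rewrite conflictE // => /hasP[c /clients_ord[c' ->]]; rewrite oE !env_rd // => h.
  by exists g', c'.
pose Z : {set 'I_nF} := [set f | val f \in zs].
have choose c : exists q : rat, [/\ q = o (solution c) \/ (q = 0 /\ solution c \in Z),
    forall g, q + d (c, solution c) <= o g + d (c, g) &
    forall z, z \in Z -> q + d (c, solution c) <= d (c, z)].
  have [x xin [x2 xmin]] := assignP s0 w0 (val c) facilities_neq0.
  rewrite -solutionE in x2.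
  exists (x.1%:R / (scale E)%:R).
  have xE : rd E (val c) x.2 = d (c, solution c) by rewrite x2 env_rd.
  split.
  - move: xin; rewrite eopt mem_cat => /orP[/mapP[z zz ex]|/mapP[g _ ex]].
      right; split; first by rewrite ex mul0r.
      by rewrite inE (_ : val _ = x.2) ?ex //= -x2 ex.
    by left; rewrite ex -oE -x2 ex.
  - move=> g; have := xmin (open_cost E g, val g); rewrite xE /= oE env_rd //; apply.
    by rewrite eopt mem_cat; apply/orP; right; apply/mapP; exists (val g) => //; exact: mem_facilities.
  - move=> z; rewrite inE => zz; have := xmin (0%N, val z); rewrite xE /= mul0r add0r env_rd //; apply.
    by rewrite eopt mem_cat; apply/orP; left; apply/mapP; exists (val z).
have [q qP] : exists q : 'I_nC -> rat, forall c, [/\ q c = o (solution c) \/ (q c = 0 /\ solution c \in Z),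
    forall g, q c + d (c, solution c) <= o g + d (c, g) &
    forall z, z \in Z -> q c + d (c, solution c) <= d (c, z)].
  by have /fin_all_exists[q qP] := choose; exists q.
apply: (@greedy_ratio _ _ _ _ _ o0 p01 _ _ (fun f => rr E f) Z _ _ _ _ _ q).
- exact: d_ge0 valid.
- exact: d_tri valid.
- move=> f; rewrite -(env_ro valid f) -(rr_paid s0 w0 f) sum_clients; apply: eq_bigr => c _.
  by rewrite env_rp // /payment env_rd.
- move=> z; rewrite inE => zz g c.
  have := inv_rent inv zz; rewrite has_map => /hasPn/(_ (val g) (mem_facilities g)) /=.
  by rewrite conflictE // => /hasPn/(_ (val c) (mem_clients c)); rewrite oE !env_rd // -ltNge.
- move=> z z'; rewrite !inE => zz zz' neq _ c.
  have := inv_far inv zz' zz; rewrite (inj_eq val_inj) eq_sym neq => /(_ _ isT (mem_clients c)).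
  by rewrite !env_rd // addrC.
- move=> f; have hf : has (conflict E f) (opened E zs).
    apply: contraT => nf.
    have : val f \in free_fac E (opened E zs) by rewrite mem_filter nf mem_facilities.
    by rewrite fr0.
  case: (inv_cover inv (mem_facilities f) hf) => [/rentP|[z zz [rz]]]; first by left.
  rewrite conflictE // => /hasP[c /clients_ord[c' ->]] h; right.
  have [z' ez] := facilities_ord (inv_sub inv zz); subst z.
  exists z'; first by rewrite inE.
  by split=> //; exists c'; move: h; rewrite !env_rd // mul0r addr0.
- by move=> c; have [] := qP c.
- by move=> c; have [] := qP c.
- by move=> c; have [] := qP c.
Qed.

Lemma solution_ratio psi : universal_cost o d p solution <= 6 * universal_cost o d p psi.
Proof.
have [_ _ p01] := valid.
case: (boolP [exists c, 0 < p c]) => [/existsP h|]; first exact: solution_ratio_pos.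
rewrite negb_exists => /forallP h.
have p0 c : p c = 0 by have := h c; have /andP[h0 _] := p01 c; rewrite -leNgt => h1; apply/eqP; rewrite eq_le h0 h1.
have cost0 chi : universal_cost o d p chi = 0.
  rewrite universal_costE !big1 ?addr0 // => [c _|f _]; first by rewrite p0 mul0r.
  by rewrite /hit big1 ?subrr ?mulr0 // => c _; rewrite p0 subr0.
by rewrite !cost0 mulr0.
Qed.
End Output.

Lemma universal_cost_ge0 nC nF (o : {ffun 'I_nF -> rat}) (d : {ffun 'I_nC * 'I_nF -> rat})
  (p : {ffun 'I_nC -> rat}) psi : valid_instance o d p -> 0 <= universal_cost o d p psi.
Proof.
move=> valid; have [o0 _ p01] := valid; rewrite universal_costE; apply: addr_ge0.
  apply: sumr_ge0 => f _; apply: mulr_ge0 => //.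
  have := hit_lower p01 (fiber psi f); suff : 0 <= Num.min 1 (\sum_(c in fiber psi f) p c) by lra.
  by rewrite le_min ler01 sumr_ge0 // => c _; have /andP[] := p01 c.
apply: sumr_ge0 => c _; apply: mulr_ge0; last exact: d_ge0 valid _ _.
by have /andP[] := p01 c.
Qed.

(** From [1 + x <= expR x] at [x = -1/6], [expR (1/6) <= 6/5], and [(6/5)^6 = 2.985984]. The number
    6 is the first [n] for which [(n/(n-1))^n] is below 3. *)
Lemma expR1_le3 (R : realType) : expR 1 <= 3 :> R.
Proof.
have h : 5 / 6 <= expR (- (1 / 6)) :> R by apply: le_trans (expR_ge1Dx _); lra.
have e6 : expR 1 = expR (1 / 6) ^+ 6 :> R.
  by rewrite -expRM_natl; congr expR; field.
have le65 : expR (1 / 6) <= 6 / 5 :> R.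
  rewrite -[1 / 6]opprK expRN invf_ple ?posrE ?expR_gt0 //; last by lra.
  by rewrite invf_div.
rewrite e6; apply: le_trans (_ : (6 / 5) ^+ 6 <= _).
  by apply: lerXn2r; rewrite ?nnegrE ?expR_ge0 //; lra.
by rewrite !exprS expr0; lra.
Qed.

Lemma fl_ratio_ge6 : 6 <= fl_ratio.
Proof.
rewrite /fl_ratio; have h1 : (1 : Rdefinitions.R) < expR 1 by rewrite expR_gt1.
rewrite ler_pdivlMr ?subr_gt0 //.
by have := expR1_le3 Rdefinitions.R; lra.
Qed.

(* There is a deterministic Turing machine M and a polynomial bound
   (|w|+1)^k such that on every valid instance (with at least one facility)
   M halts within that many steps and outputs (the encoding of) a mapping
   phi whose expected cost is at most 4e/(e-1) times that of every universal
   solution psi, i.e. of the optimal one. *)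
Theorem theorem6 :
  exists (M : TM) (k : nat),
    forall (nC nF : nat) (o : {ffun 'I_nF -> rat})
           (d : {ffun 'I_nC * 'I_nF -> rat}) (p : {ffun 'I_nC -> rat}),
      (0 < nF)%N ->
      valid_instance o d p ->
      exists phi : {ffun 'I_nC -> 'I_nF},
        halts_within M (enc_instance o d p)
          ((size (enc_instance o d p)).+1 ^ k)%N (enc_mapping phi)
        /\ forall psi : {ffun 'I_nC -> 'I_nF},
             ratr (universal_cost o d p phi)
               <= fl_ratio * ratr (universal_cost o d p psi).
Proof.
have [M [k HM]] := pt_tm pt_solve; exists M, k => nC nF o d p nF0 valid.
exists (solution o d p nF0); split.
  rewrite -solve_instance; apply: HM.
  by rewrite /enc_instance /Defs.enc_nat !size_cat /=; lia.
move=> psi; apply: le_trans (_ : ratr (6 * universal_cost o d p psi) <= _).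
  by rewrite ler_rat; exact: solution_ratio.
rewrite rmorphM /= ratr_nat; apply: ler_wpM2r; last exact: fl_ratio_ge6.
by rewrite ler0q; exact: universal_cost_ge0.
Qed.
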